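(* A board $B$ with $c=3$ colors has a perfect layout if and only if all of the following hold: (1) for every sink and every one of the four directions, there are at least two blank cells between the sink and the boundary of the grid in that direction; (2) none of the following configurations occurs: (a) a sink two cells away from three sides of the boundary and adjacent to another sink; (b) a sink two cells away from two perpendicular sides of the boundary and adjacent to the two other sinks; (c) a sink two cells away from two opposite sides of the boundary and adjacent to the two other sinks; (d) a sink two cells away from three sides of the boundary such that, in the remaining direction, exactly one blank cell separates it from another sink which is adjacent to the third sink; (3) with $p,q$ the numbers of rows and columns containing a sink: if $p=q=3$, $B$ has size at least $7\times8$; if $\{p,q\}=\{2,3\}$, size at least $7\times8$ or $6\times9$; if $p=q=2$, size at least $7\times7$ or $6\times9$; if $\{p,q\}=\{1,3\}$, size at least $7\times7$, $6\times9$, or $5\times11$.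
   Context: A board is an $m\times n$ grid of unit cells in which exactly $c$ cells are sinks, one of each of $c$ colors, and all other cells are empty. A layout places, in some of the empty cells, arrows, each having one of the $c$ colors and one of the four cardinal directions. A packet of color $i$ may enter the grid through any unit edge of the outer boundary of the grid, into the adjacent cell, moving perpendicular to that edge into the grid; it moves one cell at a time in its current direction, and whenever it enters a cell containing an arrow of color $i$ its direction becomes that arrow's direction (arrows of other colors are ignored). The packet succeeds if it enters the sink of color $i$; it fails if it enters a sink of another color, leaves the grid, or travels forever without reaching a sink. A perfect layout is a layout in which every packet of every color entering through every boundary edge succeeds. A sink is ''two cells away'' from a side of the boundary if, along its row or column toward that side, there are exactly two cells between the sink and that side, both empty. Two sinks are adjacent if their cells share an edge. A board has size at least $a\times b$ if it has at least $a$ rows and at least $b$ columns, or at least $b$ rows and at least $a$ columns. *)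

(* Defs.v *)
From Stdlib Require Import ZArith List Lia.
Import ListNotations.
Open Scope Z_scope.

(* A cell (r, c): row r in [0, m), column c in [0, n).  Row 0 is the top. *)
Definition cell := (Z * Z)%type.

Inductive dir := DN | DS | DE | DW.

Definition dvec (d : dir) : cell :=
  match d with DN => (-1, 0) | DS => (1, 0) | DE => (0, 1) | DW => (0, -1) end.

Definition shift (p : cell) (d : dir) (k : Z) : cell :=
  (fst p + k * fst (dvec d), snd p + k * snd (dvec d)).

Definition in_grid (m n : Z) (p : cell) : Prop :=
  0 <= fst p < m /\ 0 <= snd p < n.

(* Colors are 0, 1, 2 (c = 3); [sink i] is the sink cell of color i. *)
Definition cell_eqb (p q : cell) : bool :=
  Z.eqb (fst p) (fst q) && Z.eqb (snd p) (snd q).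

Definition is_sinkb (sink : nat -> cell) (p : cell) : bool :=
  cell_eqb (sink 0%nat) p || cell_eqb (sink 1%nat) p || cell_eqb (sink 2%nat) p.

Definition valid_board (m n : Z) (sink : nat -> cell) : Prop :=
  (forall i, (i < 3)%nat -> in_grid m n (sink i)) /\
  (forall i j, (i < 3)%nat -> (j < 3)%nat -> sink i = sink j -> i = j).

(* A layout: possibly an arrow (color, direction) in each cell. *)
Definition layout := cell -> option (nat * dir).

Definition valid_layout (m n : Z) (sink : nat -> cell) (L : layout) : Prop :=
  forall p i d, L p = Some (i, d) ->
    in_grid m n p /\ is_sinkb sink p = false /\ (i < 3)%nat.

(* direction after entering cell p with direction d, for a packet of color i *)
Definition new_dir (L : layout) (i : nat) (p : cell) (d : dir) : dir :=
  match L p with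
  | Some (j, d') => if Nat.eqb j i then d' else d
  | None => d
  end.

(* k-th cell entered by the packet, and its direction on entering it *)
Fixpoint traj (L : layout) (i : nat) (p0 : cell) (d0 : dir) (k : nat) : cell * dir :=
  match k with
  | O => (p0, d0)
  | S k' => let pd := traj L i p0 d0 k' in
            let d' := new_dir L i (fst pd) (snd pd) in
            (shift (fst pd) d' 1, d')
  end.

Definition succeeds (m n : Z) (sink : nat -> cell) (L : layout) (i : nat)
    (p0 : cell) (d0 : dir) : Prop :=
  exists k, fst (traj L i p0 d0 k) = sink i /\
    forall j, (j < k)%nat ->
      in_grid m n (fst (traj L i p0 d0 j)) /\
      is_sinkb sink (fst (traj L i p0 d0 j)) = false.

(* entering through a unit edge of the outer boundary *)
Definition entry (m n : Z) (p0 : cell) (d0 : dir) : Prop :=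
  (d0 = DE /\ snd p0 = 0 /\ 0 <= fst p0 < m) \/
  (d0 = DW /\ snd p0 = n - 1 /\ 0 <= fst p0 < m) \/
  (d0 = DS /\ fst p0 = 0 /\ 0 <= snd p0 < n) \/
  (d0 = DN /\ fst p0 = m - 1 /\ 0 <= snd p0 < n).

Definition perfect_layout (m n : Z) (sink : nat -> cell) (L : layout) : Prop :=
  valid_layout m n sink L /\
  forall i, (i < 3)%nat -> forall p0 d0, entry m n p0 d0 ->
    succeeds m n sink L i p0 d0.

Definition has_perfect_layout (m n : Z) (sink : nat -> cell) : Prop :=
  exists L, perfect_layout m n sink L.

(* number of cells strictly between p and the boundary side in direction d *)
Definition dist_to_side (m n : Z) (p : cell) (d : dir) : Z :=
  match d with
  | DN => fst p | DS => m - 1 - fst p | DW => snd p | DE => n - 1 - snd p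
  end.

Definition blanks_toward (m n : Z) (sink : nat -> cell) (p : cell) (d : dir) : nat :=
  length (filter (fun k => negb (is_sinkb sink (shift p d (Z.of_nat k))))
                 (seq 1 (Z.to_nat (dist_to_side m n p d)))).

Definition cond1 (m n : Z) (sink : nat -> cell) : Prop :=
  forall i, (i < 3)%nat -> forall d, (2 <= blanks_toward m n sink (sink i) d)%nat.

Definition two_away (m n : Z) (sink : nat -> cell) (p : cell) (d : dir) : Prop :=
  dist_to_side m n p d = 2 /\
  is_sinkb sink (shift p d 1) = false /\ is_sinkb sink (shift p d 2) = false.

Definition adjacent (p q : cell) : Prop :=
  Z.abs (fst p - fst q) + Z.abs (snd p - snd q) = 1.

Definition vertical (d : dir) : bool :=
  match d with DN | DS => true | _ => false end.

Definition opp (d : dir) : dir :=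
  match d with DN => DS | DS => DN | DE => DW | DW => DE end.

Definition configA (m n : Z) (sink : nat -> cell) : Prop :=
  exists i, (i < 3)%nat /\
    exists d1 d2 d3, d1 <> d2 /\ d1 <> d3 /\ d2 <> d3 /\
      two_away m n sink (sink i) d1 /\ two_away m n sink (sink i) d2 /\
      two_away m n sink (sink i) d3 /\
      exists j, (j < 3)%nat /\ j <> i /\ adjacent (sink i) (sink j).

Definition configB (m n : Z) (sink : nat -> cell) : Prop :=
  exists i, (i < 3)%nat /\
    exists d1 d2, vertical d1 <> vertical d2 /\
      two_away m n sink (sink i) d1 /\ two_away m n sink (sink i) d2 /\
      forall j, (j < 3)%nat -> j <> i -> adjacent (sink i) (sink j).

Definition configC (m n : Z) (sink : nat -> cell) : Prop :=
  exists i, (i < 3)%nat /\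
    exists d, two_away m n sink (sink i) d /\ two_away m n sink (sink i) (opp d) /\
      forall j, (j < 3)%nat -> j <> i -> adjacent (sink i) (sink j).

Definition configD (m n : Z) (sink : nat -> cell) : Prop :=
  exists i j k, (i < 3)%nat /\ (j < 3)%nat /\ (k < 3)%nat /\
    i <> j /\ i <> k /\ j <> k /\
    exists d1 d2 d3 d4, d1 <> d2 /\ d1 <> d3 /\ d1 <> d4 /\ d2 <> d3 /\
      d2 <> d4 /\ d3 <> d4 /\
      two_away m n sink (sink i) d1 /\ two_away m n sink (sink i) d2 /\
      two_away m n sink (sink i) d3 /\
      in_grid m n (shift (sink i) d4 1) /\
      is_sinkb sink (shift (sink i) d4 1) = false /\
      shift (sink i) d4 2 = sink j /\
      adjacent (sink j) (sink k).

Definition size_at_least (m n a b : Z) : Prop :=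
  (a <= m /\ b <= n) \/ (b <= m /\ a <= n).

Definition rows_with_sink (sink : nat -> cell) : nat :=
  length (nodup Z.eq_dec [fst (sink 0%nat); fst (sink 1%nat); fst (sink 2%nat)]).
Definition cols_with_sink (sink : nat -> cell) : nat :=
  length (nodup Z.eq_dec [snd (sink 0%nat); snd (sink 1%nat); snd (sink 2%nat)]).

Definition cond3 (m n : Z) (sink : nat -> cell) : Prop :=
  let p := rows_with_sink sink in
  let q := cols_with_sink sink in
  (p = 3%nat /\ q = 3%nat -> size_at_least m n 7 8) /\
  ((p = 2%nat /\ q = 3%nat) \/ (p = 3%nat /\ q = 2%nat) ->
     size_at_least m n 7 8 \/ size_at_least m n 6 9) /\
  (p = 2%nat /\ q = 2%nat -> size_at_least m n 7 7 \/ size_at_least m n 6 9) /\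
  ((p = 1%nat /\ q = 3%nat) \/ (p = 3%nat /\ q = 1%nat) ->
     size_at_least m n 7 7 \/ size_at_least m n 6 9 \/ size_at_least m n 5 11).

(* Main.v *)
(** Necessity. A packet entering along a line that does not end in its own sink must be turned
    off that line. Hence the two cells between a sink and a side at distance two hold the two
    other colours, and each sink needs some arrow of its own colour aimed at it, which rules
    out the four configurations. Counting, every line needs three arrows perpendicular to it,
    and four if it contains a sink; as each arrow is perpendicular to only one of its two
    lines, [3m + p + 3n + q <= mn - 3], which is the size condition.

    Sufficiency. Repeating a row or column without sink keeps a layout perfect, so a board is
    solved as soon as some board with smaller gaps between the sinks and the sides is, empty
    gaps being kept empty. Up to reflections and renaming colours there are six relative
    positions of the sinks, each with finitely many minimal boards, for which layouts are
    given. *)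

From Stdlib Require Import String Ascii ZArith List Lia Bool ZifyBool.
Require Import Defs.
Import ListNotations.
Open Scope Z_scope.

(** * Packets *)

(** The sizes in condition (3) are what counting leaves: the inequality reads
    [(m-3)(n-3) >= 12+p+q], and the distances to the sides add [m >= 4+p] and [n >= 4+q]. Boards
    that attain equality, such as [7] by [7] or [5] by [11] with [p+q = 4], have an arrow in every
    blank cell, which is why the small layouts come from a search and not from a formula. An empty
    gap has no line to repeat, so empty and nonempty gaps are incomparable and a single smallest
    board per relative position cannot exist. Finitely many boards suffice because the size and
    configuration conditions cannot tell apart gaps beyond a small cap: truncating all gaps at their
    caps keeps the board admissible, there are finitely many truncated boards, and each of them is a
    stretching of a drawn one. Both the drawings and this covering are verified by computation.
    Stretching works because an arrow acts in the same way when its cell is met several times in a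
    row: a packet crossing the copies of a line shadows its journey on the small board. *)

Inductive reach (m n : Z) (sink : nat -> cell) (L : layout) (i : nat) : cell -> dir -> Prop :=
| reach_sink d : reach m n sink L i (sink i) d
| reach_step p d :
    in_grid m n p -> is_sinkb sink p = false ->
    reach m n sink L i (shift p (new_dir L i p d) 1) (new_dir L i p d) ->
    reach m n sink L i p d.

Lemma traj_succ_l L i p d k :
  traj L i p d (S k) = traj L i (shift p (new_dir L i p d) 1) (new_dir L i p d) k.
Proof.
  induction k as [|k IH]; [reflexivity|].
  change (traj L i p d (S (S k))) with
    (let pd := traj L i p d (S k) in
     let d' := new_dir L i (fst pd) (snd pd) in (shift (fst pd) d' 1, d')).
  rewrite IH; reflexivity.
Qed.

(** The inductive form leaves out endless journeys by itself and replaces the step counter by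
    induction backwards from the sink, which is how every later argument about packets runs. *)
Lemma succeeds_reach m n sink L i p d :
  succeeds m n sink L i p d <-> reach m n sink L i p d.
Proof.
  split.
  - intros [k [Hk Hj]]. revert p d Hk Hj.
    induction k as [|k IH]; intros p d Hk Hj.
    + simpl in Hk; subst p; constructor.
    + destruct (Hj 0%nat ltac:(lia)) as [Hg Hs]; simpl in Hg, Hs.
      apply reach_step; auto. apply IH.
      * rewrite <- traj_succ_l; auto.
      * intros j Hjk. rewrite <- traj_succ_l. apply Hj; lia.
  - induction 1 as [d|p d Hg Hs _ [k [Hk Hj]]].
    + exists 0%nat; split; [reflexivity|lia].
    + exists (S k); split; [now rewrite traj_succ_l|].
      intros [|j] Hjk; [now simpl|]. rewrite traj_succ_l. apply Hj; lia.
Qed.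

Lemma perfect_reach m n sink L i p d :
  perfect_layout m n sink L -> (i < 3)%nat -> entry m n p d -> reach m n sink L i p d.
Proof. intros [_ H] Hi He; apply succeeds_reach; auto. Qed.

Lemma is_sinkb_true sink p :
  is_sinkb sink p = true <-> exists i, (i < 3)%nat /\ sink i = p.
Proof.
  unfold is_sinkb, cell_eqb.
  rewrite !orb_true_iff, !andb_true_iff, !Z.eqb_eq. split.
  - intros [[[A B]|[A B]]|[A B]]; [exists 0%nat|exists 1%nat|exists 2%nat];
      (split; [lia|]); apply injective_projections; auto.
  - intros [i [Hi <-]]. destruct i as [|[|[|i]]]; [auto|auto|auto|lia].
Qed.

Lemma is_sinkb_sink sink i : (i < 3)%nat -> is_sinkb sink (sink i) = true.
Proof. intros; apply is_sinkb_true; eauto. Qed.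

Lemma reach_sink_or_blank m n sink L i p d :
  reach m n sink L i p d -> p = sink i \/ in_grid m n p /\ is_sinkb sink p = false.
Proof. destruct 1; auto. Qed.

(** * Directions *)

Lemma opp_opp d : opp (opp d) = d.
Proof. destruct d; reflexivity. Qed.

Lemma dir_eq_dec (d e : dir) : {d = e} + {d <> e}.
Proof. decide equality. Qed.

Lemma shift_shift p d k l : shift (shift p d k) d l = shift p d (k + l).
Proof. unfold shift; simpl; f_equal; ring. Qed.

Lemma shift_opp p d k : shift p (opp d) k = shift p d (- k).
Proof. destruct d; unfold shift; simpl; f_equal; ring. Qed.

Lemma shift_0 p d : shift p d 0 = p.
Proof. destruct p; unfold shift; simpl; f_equal; ring. Qed.

Lemma in_grid_dist m n p : in_grid m n p <-> forall d, 0 <= dist_to_side m n p d.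
Proof.
  unfold in_grid; split.
  - intros H []; simpl; lia.
  - intros H; pose proof (H DN); pose proof (H DS); pose proof (H DE); pose proof (H DW);
      simpl in *; lia.
Qed.

Lemma dist_shift m n p d k :
  dist_to_side m n (shift p d k) d = dist_to_side m n p d - k.
Proof. destruct d; unfold shift; simpl; lia. Qed.

Lemma dist_shift_other m n p d e k :
  e <> d -> e <> opp d -> dist_to_side m n (shift p d k) e = dist_to_side m n p e.
Proof. destruct d, e; unfold shift; simpl; intros; solve [lia | congruence]. Qed.

Lemma in_grid_shift m n p d k :
  in_grid m n p -> 0 <= k <= dist_to_side m n p d -> in_grid m n (shift p d k).
Proof. unfold in_grid; destruct d; unfold shift; simpl; lia. Qed.

Lemma valid_board_pos m n sink : valid_board m n sink -> 0 < m /\ 0 < n.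
Proof. intros [H _]; specialize (H 0%nat ltac:(lia)); unfold in_grid in H; lia. Qed.

Lemma entry_dist m n p d : 0 < m -> 0 < n ->
  entry m n p d <-> in_grid m n p /\ dist_to_side m n p (opp d) = 0.
Proof.
  intros Hm Hn; unfold entry, in_grid; split.
  - intros [[-> H]|[[-> H]|[[-> H]|[-> H]]]]; simpl; lia.
  - destruct d; simpl; intros H.
    + do 3 right; split; [reflexivity|lia].
    + right; right; left; split; [reflexivity|lia].
    + left; split; [reflexivity|lia].
    + right; left; split; [reflexivity|lia].
Qed.

Lemma adjacent_shift p q : adjacent p q <-> exists d, q = shift p d 1.
Proof.
  unfold adjacent; split.
  - destruct p as [a b], q as [a' b']; simpl; intros H.
    assert (a' = a /\ b' = b + 1 \/ a' = a /\ b' = b - 1 \/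
            a' = a + 1 /\ b' = b \/ a' = a - 1 /\ b' = b) as [[-> ->]|[[-> ->]|[[-> ->]|[-> ->]]]] by lia;
      [exists DE|exists DW|exists DS|exists DN]; unfold shift; simpl; f_equal; lia.
  - intros [d ->]; destruct d; unfold shift; simpl; lia.
Qed.

Lemma vertical_neq d e : vertical d <> vertical e <-> e <> d /\ e <> opp d.
Proof. destruct d, e; simpl; split; intros; intuition congruence. Qed.

(** * Obstructions to perfect layouts *)

Lemma reach_in_grid m n sink L i p d :
  valid_board m n sink -> (i < 3)%nat -> reach m n sink L i p d -> in_grid m n p.
Proof. intros [Hg _] Hi []; auto. Qed.

(* A packet that is never turned off its line stays on the segment, and can only
   leave it at one of its two bad ends. *)
Lemma segment_arrow m n sink L i p d l :
  valid_board m n sink -> perfect_layout m n sink L -> (i < 3)%nat -> entry m n p d ->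
  0 <= l ->
  (forall k, 0 <= k < l -> is_sinkb sink (shift p d k) = false) ->
  shift p d l <> sink i ->
  ~ in_grid m n (shift p d l) \/ is_sinkb sink (shift p d l) = true ->
  exists k e, 0 <= k < l /\ L (shift p d k) = Some (i, e) /\ vertical e <> vertical d.
Proof.
  intros HB HL Hi He Hl Hblank Hend Hend'.
  pose proof (perfect_reach m n sink L i p d HL Hi He) as Hr.
  destruct (valid_board_pos _ _ _ HB) as [Hm Hn].
  apply entry_dist in He as [Hg Hd]; auto.
  assert (Hlast : forall e, ~ reach m n sink L i (shift p d l) e).
  { intros e Hre. apply reach_sink_or_blank in Hre as [|[G B]]; [auto|].
    destruct Hend'; [auto|congruence]. }
  (* Index [-1] lies outside the grid, since the packet enters at the boundary. *)
  assert (Hfirst : forall e, ~ reach m n sink L i (shift p d (-1)) e).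
  { intros e Hre. apply reach_in_grid in Hre; auto.
    rewrite in_grid_dist in Hre. specialize (Hre (opp d)).
    change (-1) with (- (1)) in Hre. rewrite <- shift_opp, dist_shift in Hre. lia. }
  (* Invariant of a packet still on the line. Arrows along the line may reverse it any number of
     times, hence [e] is [d] or [opp d]; as both ends are forbidden, a perpendicular arrow must come
     before the journey is over. *)
  assert (Hclaim : forall q e, reach m n sink L i q e ->
            forall k, q = shift p d k -> 0 <= k < l -> (e = d \/ e = opp d) ->
            exists k' e', 0 <= k' < l /\ L (shift p d k') = Some (i, e') /\ vertical e' <> vertical d).
  { induction 1 as [e|q e G B Hre IH]; intros k Hq Hk Hed.
    - specialize (Hblank k Hk). rewrite <- Hq, is_sinkb_sink in Hblank; congruence.
    - subst q. set (e' := new_dir L i (shift p d k) e) in *.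
      destruct (bool_dec (vertical e') (vertical d)) as [Hv|Hv].
      + assert (He' : e' = d \/ e' = opp d)
          by (destruct e', d; simpl in Hv |- *; auto; discriminate).
        assert (exists k2, shift (shift p d k) e' 1 = shift p d k2 /\ (k2 = k + 1 \/ k2 = k - 1))
          as [k2 [Hk2 Hk2']].
        { destruct He' as [->| ->]; [exists (k + 1)|exists (k - 1)];
            rewrite ?shift_opp, shift_shift; auto. }
        rewrite Hk2 in Hre, IH.
        assert (0 <= k2 < l \/ k2 = l \/ k2 = -1) as [Hin|[->| ->]] by lia.
        * apply (IH k2); auto.
        * exfalso; eapply Hlast; eauto.
        * exfalso; eapply Hfirst; eauto.
      + exists k, e'; split; [auto|split; [|auto]].
        unfold e', new_dir in Hv |- *.
        destruct (L (shift p d k)) as [[j f]|]; [destruct (Nat.eqb_spec j i) as [->|]|].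
        * reflexivity.
        * exfalso; apply Hv; destruct Hed; subst e; destruct d; reflexivity.
        * exfalso; apply Hv; destruct Hed; subst e; destruct d; reflexivity. }
  destruct (Z.eq_dec l 0) as [->|].
  - exfalso. apply (Hlast d). now rewrite shift_0.
  - apply (Hclaim p d Hr 0); auto; [now rewrite shift_0|lia].
Qed.

(** A packet of colour [j] sent in from side [d] straight at sink [i] meets no other sink before it,
    so it must be turned off the line in between. *)
Lemma outer_sink_arrow m n sink L i j d :
  valid_board m n sink -> perfect_layout m n sink L ->
  (i < 3)%nat -> (j < 3)%nat -> j <> i ->
  (forall k, 1 <= k <= dist_to_side m n (sink i) d -> is_sinkb sink (shift (sink i) d k) = false) ->
  exists k e, 1 <= k <= dist_to_side m n (sink i) d /\
    L (shift (sink i) d k) = Some (j, e) /\ vertical e <> vertical d.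
Proof.
  intros HB HL Hi Hj Hij Hblank.
  assert (Hg : in_grid m n (sink i)) by (apply HB; auto).
  pose proof (proj1 (in_grid_dist _ _ _) Hg d) as Hd.
  set (D := dist_to_side m n (sink i) d) in *.
  assert (Hs : forall k, shift (shift (sink i) d D) (opp d) k = shift (sink i) d (D - k))
    by (intros k; rewrite shift_opp, shift_shift; reflexivity).
  destruct (segment_arrow m n sink L j (shift (sink i) d D) (opp d) D) as [k [e [Hk [HLk He]]]]; auto.
  - destruct (valid_board_pos _ _ _ HB). apply entry_dist; auto. rewrite opp_opp, dist_shift. split; [apply in_grid_shift; auto; lia|lia].
  - intros k Hk; rewrite Hs; apply Hblank; lia.
  - rewrite Hs, Z.sub_diag, shift_0. intros E. apply HB in E; auto.
  - right. rewrite Hs, Z.sub_diag, shift_0. apply is_sinkb_sink; auto.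
  (* [k] counts from the boundary, the conclusion from the sink. *)
  - exists (D - k), e. rewrite Hs in HLk. repeat split; auto; [lia|lia|].
    destruct d; exact He.
Qed.

Lemma other_colors i : (i < 3)%nat ->
  exists j k, (j < 3)%nat /\ (k < 3)%nat /\ j <> i /\ k <> i /\ j <> k.
Proof.
  intros Hi. exists (if Nat.eqb i 0 then 1%nat else 0%nat), (if Nat.eqb i 2 then 1%nat else 2%nat).
  destruct i as [|[|[|i]]]; simpl; lia.
Qed.

(** Both foreign colours need an arrow between the sink and the side: distance 0 offers no cell for
    them, and distance 1 a single cell for two arrows of different colours. *)
Lemma perfect_dist m n sink L i d :
  valid_board m n sink -> perfect_layout m n sink L -> (i < 3)%nat ->
  2 <= dist_to_side m n (sink i) d.
Proof.
  intros HB HL Hi0.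
  assert (H0 : forall i, (i < 3)%nat -> dist_to_side m n (sink i) d <> 0).
  { intros i' Hi E. destruct (other_colors i' Hi) as [j [_ [Hj [_ [Hji _]]]]].
    destruct (outer_sink_arrow m n sink L i' j d) as [k [e [Hk _]]]; auto; intros; lia. }
  assert (Hg : in_grid m n (sink i)) by (apply HB; auto).
  pose proof (proj1 (in_grid_dist _ _ _) Hg d). specialize (H0 i Hi0) as H1.
  assert (dist_to_side m n (sink i) d <> 1); [intros E|lia].
  destruct (other_colors i Hi0) as [j [k [Hj [Hk [Hji [Hki Hjk]]]]]].
  assert (Hblank : forall k, 1 <= k <= dist_to_side m n (sink i) d ->
            is_sinkb sink (shift (sink i) d k) = false).
  { intros t Ht. apply not_true_is_false; intros Hs.
    apply is_sinkb_true in Hs as [l [Hl El]]. apply (H0 l Hl). rewrite El, dist_shift. lia. }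
  destruct (outer_sink_arrow m n sink L i j d) as [a [e [Ha [La _]]]]; auto.
  destruct (outer_sink_arrow m n sink L i k d) as [b [f [Hb [Lb _]]]]; auto.
  assert (a = b) by lia. congruence.
Qed.

Lemma perfect_cond1 m n sink L :
  valid_board m n sink -> perfect_layout m n sink L -> cond1 m n sink.
Proof.
  intros HB HL i Hi d. unfold blanks_toward.
  pose proof (perfect_dist m n sink L i d HB HL Hi) as HD.
  set (D := dist_to_side m n (sink i) d) in *.
  (* The witnesses are the two cells nearest to the boundary, at distances [D] and [D - 1] from the
     sink: a sink there would have distance 0 or 1 to the side. *)
  assert (Hin : forall k, (1 <= k <= 2)%nat -> In (Z.to_nat D + 1 - k)%nat
    (filter (fun k => negb (is_sinkb sink (shift (sink i) d (Z.of_nat k)))) (seq 1 (Z.to_nat D)))).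
  { intros k Hk. apply filter_In; split; [apply in_seq; lia|].
    apply negb_true_iff, not_true_is_false; intros Hs.
    apply is_sinkb_true in Hs as [j [Hj Ej]].
    pose proof (perfect_dist m n sink L j d HB HL Hj) as HDj.
    rewrite Ej, dist_shift in HDj. fold D in HDj. lia. }
  change 2%nat with (length [Z.to_nat D + 1 - 1; Z.to_nat D + 1 - 2]%nat).
  apply NoDup_incl_length.
  - repeat constructor; simpl; lia.
  - intros x [<-|[<-|[]]]; apply Hin; lia.
Qed.

(** * Excluding the four configurations *)

Lemma two_away_arrow m n sink L i d k :
  valid_board m n sink -> perfect_layout m n sink L -> (i < 3)%nat ->
  two_away m n sink (sink i) d -> 1 <= k <= 2 ->
  exists j e, L (shift (sink i) d k) = Some (j, e) /\ j <> i.
Proof.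
  intros HB HL Hi [HD [S1 S2]] Hk.
  assert (Hblank : forall k, 1 <= k <= dist_to_side m n (sink i) d ->
            is_sinkb sink (shift (sink i) d k) = false).
  { intros t Ht. assert (t = 1 \/ t = 2) as [->| ->] by lia; auto. }
  destruct (other_colors i Hi) as [j [j' [Hj [Hj' [Hji [Hji' Hjj]]]]]].
  destruct (outer_sink_arrow m n sink L i j d) as [a [e [Ha [La _]]]]; auto.
  destruct (outer_sink_arrow m n sink L i j' d) as [b [f [Hb [Lb _]]]]; auto.
  (* Two foreign colours share two cells, so each of the cells is taken by one of them. *)
  assert (a <> b) by congruence.
  assert (k = a \/ k = b) as [->| ->] by lia; eauto.
Qed.

(* The packet entering along the top row is aimed at the sink by the last arrow that turns it. *)
Lemma aiming_arrow m n sink L i :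
  valid_board m n sink -> perfect_layout m n sink L -> (i < 3)%nat ->
  exists d t, 1 <= t /\
    (forall s, 1 <= s <= t -> in_grid m n (shift (sink i) d s) /\
                             is_sinkb sink (shift (sink i) d s) = false) /\
    L (shift (sink i) d t) = Some (i, opp d).
Proof.
  intros HB HL Hi.
  set (goal := exists d t, _).
  (* Backwards from the sink: either an aiming arrow has been met, or the packet is still flying
     straight at the sink over blank cells. *)
  assert (Hclaim : forall p d, reach m n sink L i p d ->
    goal \/ exists t, 0 <= t /\ p = shift (sink i) (opp d) t /\
      forall s, 1 <= s <= t -> in_grid m n (shift (sink i) (opp d) s) /\
                              is_sinkb sink (shift (sink i) (opp d) s) = false).
  { induction 1 as [d|p d G B _ [IH|[t [Ht [Ep Hs]]]]]; [|auto|].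
    - right; exists 0; rewrite shift_0; repeat split; lia.
    - set (d' := new_dir L i p d) in *.
      assert (Ep' : p = shift (sink i) (opp d') (t + 1)).
      { rewrite <- shift_shift, <- Ep, shift_opp, shift_shift. simpl. now rewrite shift_0. }
      assert (Hs' : forall s, 1 <= s <= t + 1 -> in_grid m n (shift (sink i) (opp d') s) /\
                is_sinkb sink (shift (sink i) (opp d') s) = false).
      { intros s Hs1. assert (s = t + 1 \/ 1 <= s <= t) as [->|] by lia; [now rewrite <- Ep'|auto]. }
      destruct (dir_eq_dec d' d) as [E|E].
      + right; exists (t + 1). rewrite <- E. split; [lia|auto].
      + left. exists (opp d'), (t + 1). split; [lia|split; [auto|]].
        rewrite <- Ep', opp_opp. unfold d', new_dir in E |- *.
        destruct (L p) as [[j f]|]; [|congruence].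
        destruct (Nat.eqb_spec j i); congruence. }
  assert (Hg : in_grid m n (sink i)) by (apply HB; auto).
  pose proof (perfect_dist m n sink L i DN HB HL Hi) as HN. simpl in HN.
  (* The packet starts in row 0, which contains no sink, so it cannot be flying straight at the sink
     from the start. *)
  destruct (Hclaim (0, 0) DE) as [|[t [_ [E _]]]]; [|auto|].
  - apply perfect_reach; auto. left; simpl; unfold in_grid in Hg; repeat split; lia.
  - exfalso. unfold shift in E; simpl in E. injection E; lia.
Qed.

Lemma two_away_not_aiming m n sink L i d t :
  valid_board m n sink -> perfect_layout m n sink L -> (i < 3)%nat ->
  two_away m n sink (sink i) d -> 1 <= t -> in_grid m n (shift (sink i) d t) ->
  L (shift (sink i) d t) <> Some (i, opp d).
Proof.
  intros HB HL Hi Hd Ht Hg E.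
  assert (t <= 2).
  { rewrite in_grid_dist in Hg. specialize (Hg d). rewrite dist_shift in Hg.
    destruct Hd as [Hd _]. lia. }
  destruct (two_away_arrow m n sink L i d t) as [j [e [Ej Hj]]]; auto. congruence.
Qed.

(** The common core of configurations A, B and C. An aiming arrow must stand on some side of the
    sink; a neighbouring sink blocks its side, and on a side two cells away both cells belong to the
    other colours. *)
Lemma some_direction_open m n sink L i :
  valid_board m n sink -> perfect_layout m n sink L -> (i < 3)%nat ->
  ~ forall d, two_away m n sink (sink i) d \/ is_sinkb sink (shift (sink i) d 1) = true.
Proof.
  intros HB HL Hi Hall.
  destruct (aiming_arrow m n sink L i) as [d [t [Ht [Hs HLt]]]]; auto.
  destruct (Hall d) as [Hd|Hd].
  - apply (two_away_not_aiming m n sink L i d t); auto. apply Hs; lia.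
  - destruct (Hs 1) as [_ E]; [lia|congruence].
Qed.

Lemma adjacent_sink_direction m n sink i j :
  (j < 3)%nat -> adjacent (sink i) (sink j) ->
  exists e, sink j = shift (sink i) e 1 /\ is_sinkb sink (shift (sink i) e 1) = true /\
    ~ two_away m n sink (sink i) e.
Proof.
  intros Hj Ha. apply adjacent_shift in Ha as [e He].
  assert (Hs : is_sinkb sink (shift (sink i) e 1) = true) by (rewrite <- He; now apply is_sinkb_sink).
  exists e; repeat split; auto. intros [_ [S1 _]]; congruence.
Qed.

Lemma perfect_not_configA m n sink L :
  valid_board m n sink -> perfect_layout m n sink L -> ~ configA m n sink.
Proof.
  intros HB HL [i [Hi [d1 [d2 [d3 [N12 [N13 [N23 [T1 [T2 [T3 [j [Hj [_ Ha]]]]]]]]]]]]]].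
  destruct (adjacent_sink_direction m n sink i j Hj Ha) as [e [_ [Hs He]]].
  apply (some_direction_open m n sink L i HB HL Hi). intros d.
  assert (e <> d1 /\ e <> d2 /\ e <> d3) as [N1 [N2 N3]] by (repeat split; congruence).
  assert (d = e \/ d = d1 \/ d = d2 \/ d = d3) as [->|[->|[->| ->]]]; auto.
  destruct d, e, d1, d2, d3; auto; congruence.
Qed.

(** Treats B and C together: two sides are lost to the boundary and the other two to the
    neighbouring sinks, whether the lost sides are perpendicular or opposite. *)
Lemma two_neighbours_block m n sink L i d1 d2 :
  valid_board m n sink -> perfect_layout m n sink L -> (i < 3)%nat -> d1 <> d2 ->
  two_away m n sink (sink i) d1 -> two_away m n sink (sink i) d2 ->
  (forall j, (j < 3)%nat -> j <> i -> adjacent (sink i) (sink j)) -> False.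
Proof.
  intros HB HL Hi N12 T1 T2 Hadj.
  destruct (other_colors i Hi) as [j [k [Hj [Hk [Hji [Hki Hjk]]]]]].
  destruct (adjacent_sink_direction m n sink i j Hj (Hadj j Hj Hji)) as [e [Ee [Se He]]].
  destruct (adjacent_sink_direction m n sink i k Hk (Hadj k Hk Hki)) as [f [Ef [Sf Hf]]].
  apply (some_direction_open m n sink L i HB HL Hi). intros d.
  assert (e <> d1 /\ e <> d2 /\ f <> d1 /\ f <> d2) as [N1 [N2 [N3 N4]]] by (repeat split; congruence).
  assert (e <> f).
  { intros <-. apply Hjk. apply HB; auto. congruence. }
  assert (d = e \/ d = f \/ d = d1 \/ d = d2) as [->|[->|[->| ->]]]; auto.
  destruct d, e, d1, d2, f; auto; congruence.
Qed.

Lemma perfect_not_configB m n sink L :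
  valid_board m n sink -> perfect_layout m n sink L -> ~ configB m n sink.
Proof.
  intros HB HL [i [Hi [d1 [d2 [Hv [T1 [T2 Ha]]]]]]].
  apply (two_neighbours_block m n sink L i d1 d2); auto. congruence.
Qed.

Lemma perfect_not_configC m n sink L :
  valid_board m n sink -> perfect_layout m n sink L -> ~ configC m n sink.
Proof.
  intros HB HL [i [Hi [d [T1 [T2 Ha]]]]].
  apply (two_neighbours_block m n sink L i d (opp d)); auto. destruct d; discriminate.
Qed.

(* The only cell from which sink [i] can be aimed at is the one separating it from
   sink [j], which leaves no cell from which sink [j] can be aimed at. *)
Lemma perfect_not_configD m n sink L :
  valid_board m n sink -> perfect_layout m n sink L -> ~ configD m n sink.
Proof.
  intros HB HL (i & j & k & Hi & Hj & Hk & Nij & Nik & Njk & d1 & d2 & d3 & d4 &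
    N12 & N13 & N14 & N23 & N24 & N34 & T1 & T2 & T3 & G & B & Ej & Ha).
  assert (Hdir : forall d, d = d4 \/ two_away m n sink (sink i) d).
  { intros d. assert (d = d4 \/ d = d1 \/ d = d2 \/ d = d3) as [->|[->|[->| ->]]]; auto.
    destruct d, d1, d2, d3, d4; auto; congruence. }
  assert (HLi : L (shift (sink i) d4 1) = Some (i, opp d4)).
  { destruct (aiming_arrow m n sink L i) as [d [t [Ht [Hs HLt]]]]; auto.
    destruct (Hdir d) as [->|Hd].
    - assert (t = 1 \/ 2 <= t) as [->|Ht2] by lia; auto.
      destruct (Hs 2) as [_ E]; [lia|]. rewrite Ej, is_sinkb_sink in E; congruence.
    - exfalso; apply (two_away_not_aiming m n sink L i d t); auto. apply Hs; lia. }
  assert (Hback : forall t, shift (sink j) (opp d4) t = shift (sink i) d4 (2 - t))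
    by (intros t; rewrite <- Ej, shift_opp, shift_shift; reflexivity).
  (* Sink [j] is displaced from sink [i] along [d4], so it inherits the perpendicular distances. *)
  assert (Hside : forall e, e <> d4 -> e <> opp d4 -> dist_to_side m n (sink j) e = 2).
  { intros e He He'. rewrite <- Ej, dist_shift_other; auto. destruct (Hdir e) as [|[]]; auto. contradiction. }
  assert (Hside' : forall e, e <> d4 -> e <> opp d4 -> two_away m n sink (sink j) e).
  { intros e He He'. split; [auto|].
    split; apply not_true_is_false; intros Hs; apply is_sinkb_true in Hs as [l [Hl El]];
      pose proof (perfect_dist m n sink L l e HB HL Hl) as HD; rewrite El, dist_shift, Hside in HD; auto; lia. }
  destruct (adjacent_sink_direction m n sink j k Hk Ha) as [e [Ee [Se He]]].
  (* The third sink can only lie beyond [j]: the cell back towards [i] is blank, and so are the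
     cells on the perpendicular sides. *)
  assert (e = d4) as ->.
  { destruct (dir_eq_dec e d4) as [|N]; auto. destruct (dir_eq_dec e (opp d4)) as [->|N'].
    - rewrite Hback in Se. simpl in Se. congruence.
    - exfalso; apply He; auto. }
  (* Beyond [j] lies sink [k]; back towards [i] come a cell occupied by the arrow aiming at [i] and
     then sink [i]; the remaining two sides are two cells away. *)
  destruct (aiming_arrow m n sink L j) as [d [t [Ht [Hs HLt]]]]; auto.
  destruct (dir_eq_dec d d4) as [->|N].
  - destruct (Hs 1) as [_ E]; [lia|congruence].
  - destruct (dir_eq_dec d (opp d4)) as [->|N'].
    + assert (t = 1 \/ 2 <= t) as [->|Ht2] by lia.
      * rewrite Hback in HLt. simpl in HLt. congruence.
      * destruct (Hs 2) as [_ E]; [lia|]. rewrite Hback in E. simpl in E.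
        rewrite shift_0, is_sinkb_sink in E; congruence.
    + apply (two_away_not_aiming m n sink L j d t); auto. apply Hs; lia.
Qed.

(** * Symmetries *)

(* All the symmetries needed below (reflections and transpositions of colours) are
   involutions, so that [f], [e] and [c] are their own inverses. *)
Record board_iso (m n : Z) (s : nat -> cell) (m' n' : Z) (s' : nat -> cell)
    (f : cell -> cell) (e : dir -> dir) (c : nat -> nat) : Prop := {
  iso_cell : forall p, f (f p) = p;
  iso_dir : forall d, e (e d) = d;
  iso_color : forall i, c (c i) = i;
  iso_color_lt : forall i, (i < 3)%nat -> (c i < 3)%nat;
  iso_shift : forall p d k, f (shift p d k) = shift (f p) (e d) k;
  iso_opp : forall d, e (opp d) = opp (e d);
  iso_dist : forall p d, dist_to_side m' n' (f p) (e d) = dist_to_side m n p d;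
  iso_sink : forall i, (i < 3)%nat -> f (s i) = s' (c i);
  iso_size :
    m' = m /\ n' = n /\ rows_with_sink s' = rows_with_sink s /\
      cols_with_sink s' = cols_with_sink s \/
    m' = n /\ n' = m /\ rows_with_sink s' = cols_with_sink s /\
      cols_with_sink s' = rows_with_sink s
}.

Lemma iso_sym m n s m' n' s' f e c :
  board_iso m n s m' n' s' f e c -> board_iso m' n' s' m n s f e c.
Proof.
  intros [H1 H2 H3 H4 H5 H6 H7 H8 H9]; constructor; auto.
  - intros p d. rewrite <- (H1 p), <- (H2 d), H7, !H1, !H2. reflexivity.
  - intros i Hi. rewrite <- (H3 i) at 1. rewrite <- H8, H1; auto.
  - destruct H9 as [[A [B [C D]]]|[A [B [C D]]]]; [left|right]; repeat split; congruence.
Qed.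

Lemma iso_in_grid m n s m' n' s' f e c p :
  board_iso m n s m' n' s' f e c -> in_grid m n p -> in_grid m' n' (f p).
Proof.
  intros H. rewrite !in_grid_dist. intros Hd d.
  rewrite <- (iso_dir _ _ _ _ _ _ _ _ _ H d), (iso_dist _ _ _ _ _ _ _ _ _ H). auto.
Qed.

Lemma iso_valid_board m n s m' n' s' f e c :
  board_iso m n s m' n' s' f e c -> valid_board m n s -> valid_board m' n' s'.
Proof.
  intros H [Hg Hinj]. pose proof (iso_sym _ _ _ _ _ _ _ _ _ H) as [S1 S2 S3 S4 S5 S6 S7 S8 S9].
  assert (Hs : forall i, (i < 3)%nat -> s' i = f (s (c i))) by (intros i Hi; rewrite <- S8, S1; auto).
  split.
  - intros i Hi. rewrite Hs by auto. eapply iso_in_grid; eauto.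
  - intros i j Hi Hj E. rewrite <- (S3 i), <- (S3 j). f_equal. apply Hinj; auto.
    rewrite <- !S8 by auto. congruence.
Qed.

Lemma iso_is_sinkb m n s m' n' s' f e c p :
  board_iso m n s m' n' s' f e c -> is_sinkb s' (f p) = is_sinkb s p.
Proof.
  intros H. pose proof (iso_sym _ _ _ _ _ _ _ _ _ H) as HS.
  apply eq_true_iff_eq. rewrite !is_sinkb_true. split; intros [i [Hi E]]; exists (c i).
  - split; [apply HS; auto|]. rewrite <- (iso_sink _ _ _ _ _ _ _ _ _ HS), E by auto. apply H.
  - split; [apply H; auto|]. rewrite <- (iso_sink _ _ _ _ _ _ _ _ _ H), E by auto. reflexivity.
Qed.

Lemma iso_entry m n s m' n' s' f e c p d :
  board_iso m n s m' n' s' f e c -> valid_board m n s -> entry m n p d -> entry m' n' (f p) (e d).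
Proof.
  intros H HB He. destruct (valid_board_pos _ _ _ HB).
  destruct (valid_board_pos _ _ _ (iso_valid_board _ _ _ _ _ _ _ _ _ H HB)).
  apply entry_dist in He as [Hg Hd]; auto. apply entry_dist; auto.
  rewrite <- (iso_opp _ _ _ _ _ _ _ _ _ H), (iso_dist _ _ _ _ _ _ _ _ _ H).
  split; [eapply iso_in_grid; eauto|auto].
Qed.

Definition pullback (f : cell -> cell) (e : dir -> dir) (c : nat -> nat) (L : layout) : layout :=
  fun p => option_map (fun a => (c (fst a), e (snd a))) (L (f p)).

Lemma iso_perfect m n s m' n' s' f e c L :
  board_iso m n s m' n' s' f e c -> valid_board m n s ->
  perfect_layout m' n' s' L -> perfect_layout m n s (pullback f e c L).
Proof.
  intros H HB HL. pose proof (iso_sym _ _ _ _ _ _ _ _ _ H) as HS.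
  (* The symmetry commutes with turning at a cell; injectivity of [c] ensures that arrows of other
     colours stay ignored. *)
  assert (Hnew : forall i p d,
    new_dir (pullback f e c L) (c i) (f p) (e d) = e (new_dir L i p d)).
  { intros i p d. unfold new_dir, pullback. rewrite (iso_cell _ _ _ _ _ _ _ _ _ H).
    destruct (L p) as [[j d']|]; simpl; [|reflexivity].
    destruct (Nat.eqb_spec (c j) (c i)) as [E|E], (Nat.eqb_spec j i) as [E'|E']; try congruence.
    exfalso; apply E'. rewrite <- (iso_color _ _ _ _ _ _ _ _ _ H i), <- E. symmetry; apply H. }
  assert (Hreach : forall i q d, (i < 3)%nat -> reach m' n' s' L i q d ->
    reach m n s (pullback f e c L) (c i) (f q) (e d)).
  { intros i q d Hi. induction 1 as [d|q d G B _ IH].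
    - rewrite (iso_sink _ _ _ _ _ _ _ _ _ HS) by auto. constructor.
    - apply reach_step.
      + eapply iso_in_grid; eauto.
      + rewrite (iso_is_sinkb _ _ _ _ _ _ _ _ _ _ HS); auto.
      + rewrite Hnew, <- (iso_shift _ _ _ _ _ _ _ _ _ HS). apply IH. }
  split.
  - intros p i d E. unfold pullback in E. destruct (L (f p)) as [[j d']|] eqn:EL; [|discriminate].
    injection E as <- <-. apply HL in EL as [G [B Hj]].
    split; [|split].
    + rewrite <- (iso_cell _ _ _ _ _ _ _ _ _ H p). eapply iso_in_grid; eauto.
    + rewrite <- (iso_is_sinkb _ _ _ _ _ _ _ _ _ _ H); auto.
    + apply H; auto.
  - intros i Hi p d He. apply succeeds_reach.
    rewrite <- (iso_color _ _ _ _ _ _ _ _ _ H i), <- (iso_cell _ _ _ _ _ _ _ _ _ H p),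
      <- (iso_dir _ _ _ _ _ _ _ _ _ H d).
    apply Hreach; [apply H; auto|]. apply perfect_reach; auto; [apply H; auto|].
    eapply iso_entry; eauto.
Qed.

Lemma iso_two_away m n s m' n' s' f e c p d :
  board_iso m n s m' n' s' f e c ->
  two_away m n s p d -> two_away m' n' s' (f p) (e d).
Proof.
  intros H [HD [S1 S2]]. unfold two_away.
  rewrite (iso_dist _ _ _ _ _ _ _ _ _ H), <- !(iso_shift _ _ _ _ _ _ _ _ _ H),
    !(iso_is_sinkb _ _ _ _ _ _ _ _ _ _ H). auto.
Qed.

Lemma iso_adjacent m n s m' n' s' f e c p q :
  board_iso m n s m' n' s' f e c -> adjacent p q -> adjacent (f p) (f q).
Proof.
  intros H. rewrite !adjacent_shift. intros [d ->]. exists (e d). apply H.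
Qed.

Lemma iso_dir_neq m n s m' n' s' f e c d d' :
  board_iso m n s m' n' s' f e c -> d <> d' -> e d <> e d'.
Proof.
  intros H N E. apply N. rewrite <- (iso_dir _ _ _ _ _ _ _ _ _ H d), E. apply H.
Qed.

Lemma iso_color_neq m n s m' n' s' f e c i j :
  board_iso m n s m' n' s' f e c -> i <> j -> c i <> c j.
Proof.
  intros H N E. apply N. rewrite <- (iso_color _ _ _ _ _ _ _ _ _ H i), E. apply H.
Qed.

Lemma iso_all_adjacent m n s m' n' s' f e c i :
  board_iso m n s m' n' s' f e c -> (i < 3)%nat ->
  (forall j, (j < 3)%nat -> j <> i -> adjacent (s i) (s j)) ->
  forall j, (j < 3)%nat -> j <> c i -> adjacent (s' (c i)) (s' j).
Proof.
  intros H Hi Ha j Hj Hji.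
  rewrite <- (iso_color _ _ _ _ _ _ _ _ _ H j), <- !(iso_sink _ _ _ _ _ _ _ _ _ H)
    by (auto; apply H; auto).
  eapply iso_adjacent; eauto. apply Ha; [apply H; auto|].
  intros E. apply Hji. rewrite <- E. symmetry; apply H.
Qed.

Lemma iso_configA m n s m' n' s' f e c :
  board_iso m n s m' n' s' f e c -> configA m n s -> configA m' n' s'.
Proof.
  intros H (i & Hi & d1 & d2 & d3 & N12 & N13 & N23 & T1 & T2 & T3 & j & Hj & Nij & Ha).
  exists (c i); split; [apply H; auto|]. exists (e d1), (e d2), (e d3).
  rewrite <- (iso_sink _ _ _ _ _ _ _ _ _ H) by auto.
  repeat (split; [solve [eapply iso_dir_neq; eauto | eapply iso_two_away; eauto]|]).
  exists (c j). rewrite <- (iso_sink _ _ _ _ _ _ _ _ _ H) by auto.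
  split; [apply H; auto|split; [eapply iso_color_neq; eauto|eapply iso_adjacent; eauto]].
Qed.

Lemma iso_configB m n s m' n' s' f e c :
  board_iso m n s m' n' s' f e c -> configB m n s -> configB m' n' s'.
Proof.
  intros H (i & Hi & d1 & d2 & Hv & T1 & T2 & Ha).
  exists (c i); split; [apply H; auto|]. exists (e d1), (e d2).
  split; [|split; [|split]].
  - apply vertical_neq in Hv as [N1 N2]. apply vertical_neq.
    rewrite <- (iso_opp _ _ _ _ _ _ _ _ _ H). split; eapply iso_dir_neq; eauto.
  - rewrite <- (iso_sink _ _ _ _ _ _ _ _ _ H) by auto. eapply iso_two_away; eauto.
  - rewrite <- (iso_sink _ _ _ _ _ _ _ _ _ H) by auto. eapply iso_two_away; eauto.
  - eapply iso_all_adjacent; eauto.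
Qed.

Lemma iso_configC m n s m' n' s' f e c :
  board_iso m n s m' n' s' f e c -> configC m n s -> configC m' n' s'.
Proof.
  intros H (i & Hi & d & T1 & T2 & Ha).
  exists (c i); split; [apply H; auto|]. exists (e d). split; [|split].
  - rewrite <- (iso_sink _ _ _ _ _ _ _ _ _ H) by auto. eapply iso_two_away; eauto.
  - rewrite <- (iso_sink _ _ _ _ _ _ _ _ _ H), <- (iso_opp _ _ _ _ _ _ _ _ _ H) by auto.
    eapply iso_two_away; eauto.
  - eapply iso_all_adjacent; eauto.
Qed.

Lemma iso_configD m n s m' n' s' f e c :
  board_iso m n s m' n' s' f e c -> configD m n s -> configD m' n' s'.
Proof.
  intros H (i & j & k & Hi & Hj & Hk & Nij & Nik & Njk & d1 & d2 & d3 & d4 &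
    N12 & N13 & N14 & N23 & N24 & N34 & T1 & T2 & T3 & G & B & Ej & Ha).
  exists (c i), (c j), (c k).
  repeat (split; [solve [apply H; auto | eapply iso_color_neq; eauto]|]).
  exists (e d1), (e d2), (e d3), (e d4).
  rewrite <- !(iso_sink _ _ _ _ _ _ _ _ _ H) by auto.
  repeat (split; [solve [eapply iso_dir_neq; eauto | eapply iso_two_away; eauto]|]).
  rewrite <- !(iso_shift _ _ _ _ _ _ _ _ _ H), (iso_is_sinkb _ _ _ _ _ _ _ _ _ _ H).
  split; [eapply iso_in_grid; eauto|]. split; [auto|]. split; [congruence|].
  eapply iso_adjacent; eauto.
Qed.

(** Condition (3) is invariant under exchanging [m] with [n] and [p] with [q] simultaneously. *)
Lemma iso_cond3 m n s m' n' s' f e c :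
  board_iso m n s m' n' s' f e c -> cond3 m n s -> cond3 m' n' s'.
Proof.
  intros H. destruct (iso_size _ _ _ _ _ _ _ _ _ H) as [[-> [-> [E1 E2]]]|[-> [-> [E1 E2]]]];
    unfold cond3, size_at_least; rewrite E1, E2; intros; intuition lia.
Qed.

(** * Transposition, reflection and recolouring *)

Definition swap (p : cell) : cell := (snd p, fst p).
Definition swap_dir (d : dir) : dir :=
  match d with DN => DW | DW => DN | DS => DE | DE => DS end.
Definition vflip (m : Z) (p : cell) : cell := (m - 1 - fst p, snd p).
Definition vflip_dir (d : dir) : dir :=
  match d with DN => DS | DS => DN | DE => DE | DW => DW end.

Lemma iso_transpose m n s :
  board_iso m n s n m (fun i => swap (s i)) swap swap_dir (fun i => i).
Proof.
  constructor; auto.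
  - intros []; reflexivity.
  - intros []; reflexivity.
  - intros p [] k; unfold shift, swap; simpl; f_equal; lia.
  - intros []; reflexivity.
  - intros p []; reflexivity.
Qed.

Lemma length_nodup3 a b c a' b' c' :
  (a = b <-> a' = b') -> (a = c <-> a' = c') -> (b = c <-> b' = c') ->
  length (nodup Z.eq_dec [a; b; c]) = length (nodup Z.eq_dec [a'; b'; c']).
Proof.
  intros H1 H2 H3. simpl.
  repeat match goal with |- context [Z.eq_dec ?x ?y] => destruct (Z.eq_dec x y) end;
    simpl; solve [reflexivity | exfalso; intuition lia].
Qed.

Lemma iso_vflip m n s :
  board_iso m n s m n (fun i => vflip m (s i)) (vflip m) vflip_dir (fun i => i).
Proof.
  constructor; auto.
  - intros [a b]; unfold vflip; simpl; f_equal; lia.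
  - intros []; reflexivity.
  - intros p [] k; unfold shift, vflip; simpl; f_equal; lia.
  - intros []; reflexivity.
  - intros p []; simpl; lia.
  - left; repeat split; auto. unfold rows_with_sink, vflip; simpl fst.
    apply length_nodup3; lia.
Qed.

Lemma length_nodup3_01 a b c :
  length (nodup Z.eq_dec [b; a; c]) = length (nodup Z.eq_dec [a; b; c]).
Proof.
  simpl. repeat match goal with |- context [Z.eq_dec ?x ?y] => destruct (Z.eq_dec x y) end;
    simpl; lia.
Qed.

Lemma length_nodup3_12 a b c :
  length (nodup Z.eq_dec [a; c; b]) = length (nodup Z.eq_dec [a; b; c]).
Proof.
  simpl. repeat match goal with |- context [Z.eq_dec ?x ?y] => destruct (Z.eq_dec x y) end;
    simpl; lia.
Qed.

Lemma length_nodup3_02 a b c :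
  length (nodup Z.eq_dec [c; b; a]) = length (nodup Z.eq_dec [a; b; c]).
Proof. now rewrite length_nodup3_01, length_nodup3_12, length_nodup3_01. Qed.

Definition swap_colors (a b i : nat) : nat :=
  if Nat.eqb i a then b else if Nat.eqb i b then a else i.

Lemma swap_colors_invol a b i : swap_colors a b (swap_colors a b i) = i.
Proof.
  unfold swap_colors. destruct (Nat.eqb_spec i a), (Nat.eqb_spec i b);
  repeat match goal with |- context [Nat.eqb ?x ?y] => destruct (Nat.eqb_spec x y) end; congruence.
Qed.

Lemma iso_recolor m n s a b : (a < 3)%nat -> (b < 3)%nat ->
  board_iso m n s m n (fun i => s (swap_colors a b i)) (fun p => p) (fun d => d) (swap_colors a b).
Proof.
  intros Ha Hb. constructor; auto.
  - apply swap_colors_invol.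
  - intros i Hi; unfold swap_colors; destruct (Nat.eqb i a), (Nat.eqb i b); auto.
  - intros i Hi; now rewrite swap_colors_invol.
  - left; repeat split; auto; unfold rows_with_sink, cols_with_sink;
      destruct a as [|[|[|a]]], b as [|[|[|b]]]; try lia; unfold swap_colors; cbn [Nat.eqb];
      auto using length_nodup3_01, length_nodup3_12, length_nodup3_02.
Qed.

(** * Counting arrows *)

Definition zrange (n : Z) : list Z := map Z.of_nat (seq 0 (Z.to_nat n)).

Lemma in_zrange n x : In x (zrange n) <-> 0 <= x < n.
Proof.
  unfold zrange. rewrite in_map_iff. split.
  - intros [k [<- Hk]]. apply in_seq in Hk. lia.
  - intros Hx. exists (Z.to_nat x). rewrite in_seq. lia.
Qed.

Lemma length_zrange n : length (zrange n) = Z.to_nat n.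
Proof. unfold zrange. now rewrite length_map, length_seq. Qed.

Definition count {A} (f : A -> bool) (l : list A) : Z := Z.of_nat (length (filter f l)).

Definition lsum {A} (f : A -> Z) (l : list A) : Z := fold_right (fun x t => f x + t) 0 l.

Lemma count_lsum {A} (f : A -> bool) l : count f l = lsum (fun x => Z.b2z (f x)) l.
Proof.
  unfold count. induction l as [|x l IH]; [reflexivity|]. simpl.
  rewrite <- IH. destruct (f x); simpl length; simpl Z.b2z; lia.
Qed.

Lemma lsum_le {A} (f g : A -> Z) l :
  (forall x, In x l -> f x <= g x) -> lsum f l <= lsum g l.
Proof.
  induction l as [|x l IH]; simpl; intros H; [lia|].
  pose proof (H x (or_introl eq_refl)). assert (lsum f l <= lsum g l) by auto. lia.
Qed.

Lemma lsum_ext {A} (f g : A -> Z) l : (forall x, f x = g x) -> lsum f l = lsum g l.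
Proof. intros H; induction l; simpl; rewrite ?H; congruence. Qed.

Lemma lsum_add {A} (f g : A -> Z) l : lsum (fun x => f x + g x) l = lsum f l + lsum g l.
Proof. induction l; simpl; lia. Qed.

Lemma lsum_const {A} k (l : list A) : lsum (fun _ => k) l = k * Z.of_nat (length l).
Proof. induction l; simpl lsum; simpl length; lia. Qed.

Lemma lsum_exchange {A B} (f : A -> B -> Z) l l' :
  lsum (fun x => lsum (f x) l') l = lsum (fun y => lsum (fun x => f x y) l) l'.
Proof.
  induction l as [|x l IH]; simpl.
  - rewrite lsum_const; lia.
  - rewrite IH, <- lsum_add. reflexivity.
Qed.

Lemma lsum_list_prod {A B} (f : A * B -> Z) l l' :
  lsum f (list_prod l l') = lsum (fun x => lsum (fun y => f (x, y)) l') l.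
Proof.
  assert (Happ : forall l1 l2, lsum f (l1 ++ l2) = lsum f l1 + lsum f l2)
    by (induction l1; intros; simpl; rewrite ?IHl1; lia).
  induction l as [|x l IH]; [reflexivity|]. simpl. rewrite Happ, IH. f_equal.
  clear. induction l'; simpl; congruence.
Qed.

Lemma count_ge {A} (f : A -> bool) l w :
  NoDup w -> (forall x, In x w -> In x l /\ f x = true) -> Z.of_nat (length w) <= count f l.
Proof.
  intros HN H. unfold count. apply Nat2Z.inj_le, NoDup_incl_length; auto.
  intros x Hx. apply filter_In; auto.
Qed.

(** Provides the sink to which [outer_sink_arrow] applies when several sinks share a line. Passing
    to any sink further along [d] shortens the distance to the side, so the descent ends. *)
Lemma outermost_sink m n sink d i :
  valid_board m n sink -> (i < 3)%nat ->
  exists j k, (j < 3)%nat /\ 0 <= k /\ sink j = shift (sink i) d k /\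
    forall t, 1 <= t <= dist_to_side m n (sink j) d -> is_sinkb sink (shift (sink j) d t) = false.
Proof.
  intros HB. remember (Z.to_nat (dist_to_side m n (sink i) d)) as N eqn:EN.
  revert i EN. induction N as [N IH] using lt_wf_ind. intros i EN Hi.
  destruct (existsb (fun t => is_sinkb sink (shift (sink i) d (Z.of_nat t))) (seq 1 N)) eqn:E.
  - apply existsb_exists in E as [t [Ht Hs]]. apply in_seq in Ht.
    apply is_sinkb_true in Hs as [l [Hl El]].
    destruct (IH (N - t)%nat) with (i := l) as [j [k [Hj [Hk [Ej Hb]]]]]; auto; [lia| |].
    + rewrite El, dist_shift. lia.
    + exists j, (Z.of_nat t + k). rewrite Ej, El, shift_shift. repeat split; auto; [lia|].
      rewrite <- shift_shift, <- El, <- Ej. auto.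
  - exists i, 0. rewrite shift_0. repeat split; auto; [lia|]. intros t Ht.
    apply not_true_is_false; intros Hs.
    enough (existsb (fun t => is_sinkb sink (shift (sink i) d (Z.of_nat t))) (seq 1 N) = true)
      by congruence.
    apply existsb_exists. exists (Z.to_nat t). rewrite in_seq, Z2Nat.id by lia.
    split; [lia|auto].
Qed.

Definition vertical_arrow (o : option (nat * dir)) : bool :=
  match o with Some (_, d) => vertical d | None => false end.
Definition horizontal_arrow (o : option (nat * dir)) : bool :=
  match o with Some (_, d) => negb (vertical d) | None => false end.
Definition row_has_sink (sink : nat -> cell) (r : Z) : bool :=
  Z.eqb (fst (sink 0%nat)) r || Z.eqb (fst (sink 1%nat)) r || Z.eqb (fst (sink 2%nat)) r.

Lemma row_has_sink_true sink r :
  row_has_sink sink r = true <-> exists i, (i < 3)%nat /\ fst (sink i) = r.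
Proof.
  unfold row_has_sink. rewrite !orb_true_iff, !Z.eqb_eq. split.
  - intros [[E|E]|E]; [exists 0%nat|exists 1%nat|exists 2%nat]; auto with arith.
  - intros [[|[|[|i]]] [Hi E]]; auto; lia.
Qed.

(* A row without sinks turns every colour at least once; in a row with sinks, the two
   colours not received by the outermost sink must be turned on either side. *)
Lemma row_vertical_arrows m n sink L r :
  valid_board m n sink -> perfect_layout m n sink L -> 0 <= r < m ->
  3 + Z.b2z (row_has_sink sink r) <= count (fun c => vertical_arrow (L (r, c))) (zrange n).
Proof.
  intros HB HL Hr. destruct (row_has_sink sink r) eqn:E.
  - apply row_has_sink_true in E as [i [Hi Er]].
    (* The outermost sinks on the two sides may differ. Comparing columns with the fixed sink [i]
       keeps the two pairs of arrows apart. *)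
    assert (Hside : forall d, d = DE \/ d = DW -> exists x y, x <> y /\
      (forall z, z = x \/ z = y -> In z (zrange n) /\ vertical_arrow (L (r, z)) = true /\
         match d with DE => snd (sink i) < z | _ => z < snd (sink i) end)).
    { intros d Hd.
      destruct (outermost_sink m n sink d i HB Hi) as [j [k [Hj [Hk [Ej Hb]]]]].
      assert (Hone : forall l, (l < 3)%nat -> l <> j -> exists z e, L (r, z) = Some (l, e) /\
        In z (zrange n) /\ vertical_arrow (L (r, z)) = true /\
         match d with DE => snd (sink i) < z | _ => z < snd (sink i) end).
      { intros l Hl Hlj.
        destruct (outer_sink_arrow m n sink L j l d) as [t [e [Ht [HLt He]]]]; auto.
        assert (Hg : in_grid m n (shift (sink j) d t)) by (apply HL in HLt; apply HLt).
        assert (Ec : shift (sink j) d t = (r, snd (shift (sink j) d t))).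
        { rewrite Ej, shift_shift. unfold shift. destruct Hd; subst d; simpl; f_equal; lia. }
        exists (snd (shift (sink j) d t)), e. rewrite <- Ec. repeat split; auto.
        - apply in_zrange. apply Hg.
        - rewrite HLt. simpl. destruct Hd; subst d; simpl in He; destruct (vertical e); congruence.
        - rewrite Ej, shift_shift. destruct Hd; subst d; unfold shift; simpl; lia. }
      destruct (other_colors j Hj) as [l [l' [Hl [Hl' [N [N' Nl]]]]]].
      destruct (Hone l Hl N) as [x [e [Lx Hx]]]. destruct (Hone l' Hl' N') as [y [e' [Ly Hy]]].
      exists x, y. split; [congruence|]. intros z [->| ->]; auto. }
    destruct (Hside DE) as [x [y [Nxy Hxy]]]; auto.
    destruct (Hside DW) as [u [v [Nuv Huv]]]; auto.
    destruct (Hxy x) as [Ix [Vx Cx]]; auto. destruct (Hxy y) as [Iy [Vy Cy]]; auto.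
    destruct (Huv u) as [Iu [Vu Cu]]; auto. destruct (Huv v) as [Iv [Vv Cv]]; auto.
    apply (count_ge _ _ [x; y; u; v]).
    + repeat constructor; simpl; intuition lia.
    + simpl; intros z [<-|[<-|[<-|[<-|[]]]]]; auto.
  - assert (Hs : forall k, shift (r, 0) DE k = (r, k)) by (intros; unfold shift; simpl; f_equal; lia).
    assert (Hone : forall i, (i < 3)%nat -> exists z e, L (r, z) = Some (i, e) /\
        In z (zrange n) /\ vertical_arrow (L (r, z)) = true).
    { intros i Hi. destruct (valid_board_pos _ _ _ HB) as [Hm Hn].
      assert (Hout : ~ in_grid m n (shift (r, 0) DE n)) by (rewrite Hs; unfold in_grid; simpl; lia).
      destruct (segment_arrow m n sink L i (r, 0) DE n) as [k [e [Hk [HLk He]]]]; auto.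
      - left; auto.
      - lia.
      - intros k Hk. rewrite Hs. apply not_true_is_false; intros Hk'.
        apply is_sinkb_true in Hk' as [j [Hj Ej]].
        enough (row_has_sink sink r = true) by congruence.
        apply row_has_sink_true; exists j; rewrite Ej; auto.
      - intros E'. apply Hout. rewrite E'. apply HB; auto.
      - rewrite Hs in HLk. exists k, e. rewrite HLk. split; [auto|]. split; [now apply in_zrange|].
        simpl in *. destruct (vertical e); congruence. }
    destruct (Hone 0%nat) as [x [ex [Lx Hx]]]; [lia|].
    destruct (Hone 1%nat) as [y [ey [Ly Hy]]]; [lia|].
    destruct (Hone 2%nat) as [z [ez [Lz Hz]]]; [lia|].
    apply (count_ge _ _ [x; y; z]).
    + assert (x <> y /\ x <> z /\ y <> z) by (repeat split; congruence).
      repeat constructor; simpl; intuition.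
    + simpl; intros t [<-|[<-|[<-|[]]]]; auto.
Qed.

Lemma vertical_arrows m n sink L :
  valid_board m n sink -> perfect_layout m n sink L ->
  3 * m + Z.of_nat (rows_with_sink sink) <=
    lsum (fun r => count (fun c => vertical_arrow (L (r, c))) (zrange n)) (zrange m).
Proof.
  intros HB HL. destruct (valid_board_pos _ _ _ HB) as [Hm _].
  transitivity (lsum (fun r => 3 + Z.b2z (row_has_sink sink r)) (zrange m)).
  - rewrite lsum_add, lsum_const, length_zrange, <- count_lsum.
    enough (Z.of_nat (rows_with_sink sink) <= count (row_has_sink sink) (zrange m)) by lia.
    apply count_ge; [apply NoDup_nodup|]. intros x Hx. apply nodup_In in Hx.
    assert (exists i, (i < 3)%nat /\ fst (sink i) = x) as [i [Hi Ei]]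
      by (simpl in Hx; destruct Hx as [E|[E|[E|[]]]]; eauto with arith).
    split; [|apply row_has_sink_true; eauto].
    apply in_zrange. rewrite <- Ei. apply HB; auto.
  - apply lsum_le. intros r Hr. apply (row_vertical_arrows m n sink L); auto. now apply in_zrange.
Qed.

(** A cell is at most one of three things: a vertical arrow, a horizontal arrow or a sink. The bound
    for columns is the bound for rows on the transposed board. *)
Lemma perfect_size m n sink L :
  valid_board m n sink -> perfect_layout m n sink L ->
  3 * m + Z.of_nat (rows_with_sink sink) + 3 * n + Z.of_nat (cols_with_sink sink) + 3 <= m * n.
Proof.
  intros HB HL. destruct (valid_board_pos _ _ _ HB) as [Hm Hn].
  pose proof (vertical_arrows m n sink L HB HL) as HV.
  pose proof (iso_sym _ _ _ _ _ _ _ _ _ (iso_transpose m n sink)) as HT.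
  pose proof (iso_valid_board _ _ _ _ _ _ _ _ _ (iso_transpose m n sink) HB) as HBT.
  pose proof (vertical_arrows _ _ _ _ HBT (iso_perfect _ _ _ _ _ _ _ _ _ _ HT HBT HL)) as HH.
  change (rows_with_sink (fun i => swap (sink i))) with (cols_with_sink sink) in HH.
  set (cells := list_prod (zrange m) (zrange n)).
  assert (HS : 3 <= count (fun p : Z * Z => is_sinkb sink p) cells).
  { apply (count_ge _ _ [sink 0%nat; sink 1%nat; sink 2%nat]).
    - assert (sink 0%nat <> sink 1%nat /\ sink 0%nat <> sink 2%nat /\ sink 1%nat <> sink 2%nat)
        by (repeat split; intros E; apply HB in E; lia).
      repeat constructor; simpl; intuition.
    - assert (Hin : forall i, (i < 3)%nat -> In (sink i) cells /\ is_sinkb sink (sink i) = true).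
      { intros i Hi. split; [|now apply is_sinkb_sink]. unfold cells.
        destruct HB as [Hg _]. specialize (Hg i Hi). destruct (sink i) as [a b].
        apply in_prod; apply in_zrange; apply Hg. }
      simpl; intros p [<-|[<-|[<-|[]]]]; apply Hin; lia. }
  assert (HVc : lsum (fun r => count (fun c => vertical_arrow (L (r, c))) (zrange n)) (zrange m)
                = lsum (fun p : Z * Z => Z.b2z (vertical_arrow (L p))) cells).
  { unfold cells. rewrite lsum_list_prod. apply lsum_ext; intros r. apply count_lsum. }
  (* The vertical arrows of the transposed layout are the horizontal arrows of [L]; the two
     summations are exchanged. *)
  assert (HHc : lsum (fun c => count (fun r => vertical_arrow
                  (pullback swap swap_dir (fun i => i) L (c, r))) (zrange m)) (zrange n)
                = lsum (fun p : Z * Z => Z.b2z (horizontal_arrow (L p))) cells).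
  { unfold cells. rewrite lsum_list_prod, lsum_exchange. apply lsum_ext; intros c.
    rewrite count_lsum. apply lsum_ext; intros r. unfold pullback, swap; simpl.
    destruct (L (r, c)) as [[j []]|]; reflexivity. }
  assert (Hcells : lsum (fun p : Z * Z => 1) cells = m * n).
  { unfold cells. rewrite lsum_const, length_prod, !length_zrange. lia. }
  assert (Hle : lsum (fun p : Z * Z => Z.b2z (vertical_arrow (L p)) + Z.b2z (horizontal_arrow (L p))
                        + Z.b2z (is_sinkb sink p)) cells <= lsum (fun _ : Z * Z => 1) cells).
  { apply lsum_le. intros p _. destruct (L p) as [[j d]|] eqn:E; simpl.
    - apply HL in E as [_ [-> _]]. destruct (vertical d); simpl; lia.
    - destruct (is_sinkb sink p); simpl; lia. }
  rewrite !lsum_add, <- HVc, <- HHc, Hcells in Hle. rewrite count_lsum in HS. lia.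
Qed.

Lemma rows_with_sink_cases sink :
  let a := fst (sink 0%nat) in let b := fst (sink 1%nat) in let c := fst (sink 2%nat) in
  rows_with_sink sink = 1%nat /\ a = b /\ b = c \/
  rows_with_sink sink = 2%nat /\ (a = b /\ b <> c \/ a = c /\ b <> c \/ b = c /\ a <> b) \/
  rows_with_sink sink = 3%nat /\ a <> b /\ a <> c /\ b <> c.
Proof.
  cbv zeta. unfold rows_with_sink. simpl.
  repeat match goal with |- context [Z.eq_dec ?x ?y] => destruct (Z.eq_dec x y) end;
    simpl; lia.
Qed.

(** In the form [(m-3)(n-3) >= 12+p+q] the count excludes just the sizes needed: [7] by [7] gives
    16, [6] by [8] gives 15 and [5] by [10] gives 14, against 18, 17, 16 and 16 in the four
    cases. *)
Lemma perfect_cond3 m n sink L :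
  valid_board m n sink -> perfect_layout m n sink L -> cond3 m n sink.
Proof.
  intros HB HL. pose proof (perfect_size m n sink L HB HL) as HS.
  (* The [p] rows with sinks have at least two free rows on either side. *)
  assert (Hm : 4 + Z.of_nat (rows_with_sink sink) <= m).
  { pose proof (fun i Hi => perfect_dist m n sink L i DN HB HL Hi) as H1.
    pose proof (fun i Hi => perfect_dist m n sink L i DS HB HL Hi) as H2.
    simpl in H1, H2.
    pose proof (H1 0%nat ltac:(lia)); pose proof (H1 1%nat ltac:(lia));
    pose proof (H1 2%nat ltac:(lia)); pose proof (H2 0%nat ltac:(lia));
    pose proof (H2 1%nat ltac:(lia)); pose proof (H2 2%nat ltac:(lia)).
    pose proof (rows_with_sink_cases sink) as Hc; cbv zeta in Hc. lia. }
  assert (Hn : 4 + Z.of_nat (cols_with_sink sink) <= n).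
  { pose proof (fun i Hi => perfect_dist m n sink L i DW HB HL Hi) as H1.
    pose proof (fun i Hi => perfect_dist m n sink L i DE HB HL Hi) as H2.
    simpl in H1, H2.
    pose proof (H1 0%nat ltac:(lia)); pose proof (H1 1%nat ltac:(lia));
    pose proof (H1 2%nat ltac:(lia)); pose proof (H2 0%nat ltac:(lia));
    pose proof (H2 1%nat ltac:(lia)); pose proof (H2 2%nat ltac:(lia)).
    pose proof (rows_with_sink_cases (fun i => swap (sink i))) as Hc; cbv zeta in Hc.
    change (rows_with_sink (fun i => swap (sink i))) with (cols_with_sink sink) in Hc.
    simpl in Hc. lia. }
  unfold cond3, size_at_least. cbv zeta. repeat split; intros H.
  - destruct H as [E1 E2]; rewrite E1, E2 in *.
    assert (~ (m = 7 /\ n = 7)) by (intros [-> ->]; lia). lia.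
  - destruct H as [[E1 E2]|[E1 E2]]; rewrite E1, E2 in *.
    + assert (~ (m = 7 /\ n = 7)) by (intros [-> ->]; lia).
      assert (~ (m = 6 /\ n <= 8)) by (intros [-> ?]; lia). lia.
    + assert (~ (m = 7 /\ n = 7)) by (intros [-> ->]; lia).
      assert (~ (n = 6 /\ m <= 8)) by (intros [-> ?]; lia). lia.
  - destruct H as [E1 E2]; rewrite E1, E2 in *.
    assert (~ (m = 6 /\ n <= 8)) by (intros [-> ?]; lia).
    assert (~ (n = 6 /\ m <= 8)) by (intros [-> ?]; lia). lia.
  - destruct H as [[E1 E2]|[E1 E2]]; rewrite E1, E2 in *.
    + assert (~ (m = 5 /\ n <= 10)) by (intros [-> ?]; lia).
      assert (~ (m = 6 /\ n <= 8)) by (intros [-> ?]; lia). lia.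
    + assert (~ (n = 5 /\ m <= 10)) by (intros [-> ?]; lia).
      assert (~ (n = 6 /\ m <= 8)) by (intros [-> ?]; lia). lia.
Qed.

(** * Duplicating rows and columns without sinks *)

(* A coordinate axis is described by the list of its gaps, the maximal runs of lines without
   sink: [pos g k] is the [k]-th line with a sink, and the far end of the axis counts as
   the last such line, so that its length is [axis_length g]. *)
Fixpoint pos (g : list Z) (k : nat) : Z :=
  match g with
  | [] => 0
  | a :: g' => match k with O => a | S k' => a + 1 + pos g' k' end
  end.

Definition axis_length (g : list Z) : Z := pos g (pred (length g)).

(* A gap can be stretched by repeating one of its lines, hence only if it is not empty. *)
Definition gap_le (a b : Z) : Prop := 0 <= a <= b /\ (a = 0 -> b = 0).

(** Maps the long axis [h] onto the short axis [g]. The last line of each gap of [g] is the one that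
    is repeated, and lines with sinks go to lines with sinks. *)
Fixpoint collapse (g h : list Z) (x : Z) : Z :=
  match g, h with
  | a :: g', b :: h' =>
      if x <? b then Z.min x (a - 1) else if x =? b then a else a + 1 + collapse g' h' (x - b - 1)
  | _, _ => x
  end.

Ltac collapse_cases :=
  cbn [collapse pos]; repeat match goal with
  | |- context [?x <? ?y] => destruct (Z.ltb_spec x y)
  | |- context [?x =? ?y] => destruct (Z.eqb_spec x y)
  end; try lia.

Lemma pos_nonneg g k : Forall (Z.le 0) g -> 0 <= pos g k.
Proof.
  intros H; revert k; induction H as [|a g Ha _ IH]; intros [|k]; simpl; try lia.
  specialize (IH k); lia.
Qed.

Lemma gap_le_nonneg g h : Forall2 gap_le g h -> Forall (Z.le 0) g /\ Forall (Z.le 0) h.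
Proof.
  induction 1 as [|a b g h [Hab _] _ [IH1 IH2]]; split; constructor; auto; lia.
Qed.

Lemma collapse_pos g h k :
  Forall2 gap_le g h -> (k < length g)%nat -> collapse g h (pos h k) = pos g k.
Proof.
  intros H; revert k; induction H as [|a b g h [Hab H0] H IH]; intros [|k]; simpl; intros Hk; try lia.
  - collapse_cases.
  - pose proof (pos_nonneg h k (proj2 (gap_le_nonneg _ _ H))). collapse_cases.
    replace (b + 1 + pos h k - b - 1) with (pos h k) by lia. rewrite IH; lia.
Qed.

Lemma collapse_0 g h : Forall2 gap_le g h -> collapse g h 0 = 0.
Proof. intros [|a b g' h' [Hab H0] H]; collapse_cases. Qed.

Lemma collapse_opp1 g h : Forall2 gap_le g h -> collapse g h (-1) = -1.
Proof. intros [|a b g' h' [Hab H0] H]; collapse_cases. Qed.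

Lemma collapse_nonneg g h x : Forall2 gap_le g h -> 0 <= x -> 0 <= collapse g h x.
Proof.
  intros H; revert x; induction H as [|a b g h [Hab H0] H IH]; intros x Hx; collapse_cases.
  specialize (IH (x - b - 1)); lia.
Qed.

(** Lines with sinks are never repeated. Hence a packet whose image stands on a sink stands on that
    sink itself, and not on a blank copy. *)
Lemma collapse_pos_inv g h k x :
  Forall2 gap_le g h -> (k < length g)%nat -> 0 <= x -> collapse g h x = pos g k -> x = pos h k.
Proof.
  intros H; revert k x; induction H as [|a b g h [Hab H0] H IH]; intros [|k] x; simpl; intros Hk Hx;
    try lia.
  - collapse_cases. pose proof (collapse_nonneg g h (x - b - 1) H). lia.
  - pose proof (pos_nonneg g k (proj1 (gap_le_nonneg _ _ H))). collapse_cases.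
    intros E. specialize (IH k (x - b - 1)). lia.
Qed.

(** Discrete continuity: while the packet makes one move, its image makes the same move or waits. *)
Lemma collapse_step g h x :
  Forall2 gap_le g h -> 0 <= x ->
  collapse g h (x + 1) = collapse g h x \/ collapse g h (x + 1) = collapse g h x + 1.
Proof.
  intros H; revert x; induction H as [|a b g h [Hab H0] H IH]; intros x Hx; collapse_cases.
  - subst x. replace (b + 1 - b - 1) with 0 by lia. rewrite collapse_0 by auto. lia.
  - replace (x + 1 - b - 1) with (x - b - 1 + 1) by lia. specialize (IH (x - b - 1)). lia.
Qed.

Lemma collapse_lt g h x :
  Forall2 gap_le g h -> 0 <= x < axis_length h -> collapse g h x < axis_length g.
Proof.
  unfold axis_length. intros H; revert x; induction H as [|a b g h [Hab H0] H IH]; intros x Hx.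
  - simpl in *; lia.
  - inversion H as [|a' b' g' h' Hab' H' E1 E2].
    + subst. simpl in *. collapse_cases.
    + rewrite E1, E2.
      assert (Eg : pos (a :: g) (pred (length (a :: g))) = a + 1 + pos g (pred (length g)))
        by (subst g; reflexivity).
      assert (Eh : pos (b :: h) (pred (length (b :: h))) = b + 1 + pos h (pred (length h)))
        by (subst h; reflexivity).
      rewrite Eg. rewrite Eh in Hx.
      pose proof (pos_nonneg g (pred (length g)) (proj1 (gap_le_nonneg _ _ H))).
      collapse_cases. specialize (IH (x - b - 1)). lia.
Qed.

Lemma collapse_length g h :
  Forall2 gap_le g h -> 0 < axis_length h -> collapse g h (axis_length h) = axis_length g.
Proof.
  intros H Hpos. unfold axis_length. rewrite (Forall2_length H). apply collapse_pos; auto.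
  rewrite (Forall2_length H). destruct h; simpl; [|lia].
  unfold axis_length in Hpos; simpl in Hpos; lia.
Qed.

(** Together with [collapse_0], this sends boundary entries to boundary entries. *)
Lemma collapse_last g h :
  Forall2 gap_le g h -> 0 < axis_length h ->
  collapse g h (axis_length h - 1) = axis_length g - 1.
Proof.
  intros H Hpos. pose proof (collapse_lt g h (axis_length h - 1) H).
  destruct (collapse_step g h (axis_length h - 1)) as [E|E]; auto; [lia| |];
    replace (axis_length h - 1 + 1) with (axis_length h) in E by lia;
    rewrite collapse_length in E; auto; lia.
Qed.

Definition gap_sink (pat : nat -> nat * nat) (g1 g2 : list Z) (i : nat) : cell :=
  (pos g1 (fst (pat i)), pos g2 (snd (pat i))).

Definition in_gridb (m n : Z) (p : cell) : bool :=
  (0 <=? fst p) && (fst p <? m) && (0 <=? snd p) && (snd p <? n).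

Lemma in_gridb_true m n p : in_gridb m n p = true <-> in_grid m n p.
Proof.
  unfold in_gridb, in_grid. rewrite !andb_true_iff, !Z.leb_le, !Z.ltb_lt. tauto.
Qed.

Lemma new_dir_idem L i p d : new_dir L i p (new_dir L i p d) = new_dir L i p d.
Proof. unfold new_dir. destruct (L p) as [[j d']|]; [destruct (Nat.eqb j i)|]; reflexivity. Qed.

(* In the stretched board a packet repeats the journey of its image in the small board,
   lingering in the copies of a line before leaving them in the same direction. *)
Lemma stretch_perfect pat g1 g2 h1 h2 :
  Forall2 gap_le g1 h1 -> Forall2 gap_le g2 h2 ->
  valid_board (axis_length h1) (axis_length h2) (gap_sink pat h1 h2) ->
  (forall i, (i < 3)%nat -> (fst (pat i) < length g1)%nat /\ (snd (pat i) < length g2)%nat) ->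
  has_perfect_layout (axis_length g1) (axis_length g2) (gap_sink pat g1 g2) ->
  has_perfect_layout (axis_length h1) (axis_length h2) (gap_sink pat h1 h2).
Proof.
  intros H1 H2 HB Hpat [L HL]. destruct (valid_board_pos _ _ _ HB) as [P1 P2].
  set (m := axis_length g1) in *. set (n := axis_length g2) in *.
  set (m' := axis_length h1) in *. set (n' := axis_length h2) in *.
  set (s := gap_sink pat g1 g2) in *. set (s' := gap_sink pat h1 h2) in *.
  set (f := fun p : cell => (collapse g1 h1 (fst p), collapse g2 h2 (snd p))).
  set (L' := fun p => if in_gridb m' n' p then L (f p) else None).
  assert (Hgrid : forall p, in_grid m' n' p -> in_grid m n (f p)).
  { intros [x y] [Hx Hy]; unfold f; simpl in *. repeat split; simpl;
      solve [apply collapse_nonneg; auto; lia | apply collapse_lt; auto]. }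
  assert (Hsink : forall i p, (i < 3)%nat -> in_grid m' n' p -> f p = s i -> p = s' i).
  { intros i [x y] Hi [Hx Hy] E. destruct (Hpat i Hi) as [Hp Hq].
    unfold f, s, gap_sink in E. injection E as E1 E2. simpl in *.
    unfold s', gap_sink. f_equal.
    - apply (collapse_pos_inv g1 h1); auto; lia.
    - apply (collapse_pos_inv g2 h2); auto; lia. }
  assert (Hfs : forall i, (i < 3)%nat -> f (s' i) = s i).
  { intros i Hi. destruct (Hpat i Hi) as [Hp Hq]. unfold f, s', s, gap_sink; simpl.
    f_equal; apply collapse_pos; auto. }
  assert (Hblank : forall p, is_sinkb s (f p) = false -> is_sinkb s' p = false).
  { intros p Hp. apply not_true_is_false; intros E. apply is_sinkb_true in E as [i [Hi <-]].
    rewrite Hfs, is_sinkb_sink in Hp; auto; discriminate. }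
  assert (Hnew : forall i p d, in_grid m' n' p -> new_dir L' i p d = new_dir L i (f p) d).
  { intros i p d Hp. unfold new_dir, L'. apply in_gridb_true in Hp. now rewrite Hp. }
  assert (Hout1 : collapse g1 h1 m' = m) by (apply collapse_length; auto).
  assert (Hout2 : collapse g2 h2 n' = n) by (apply collapse_length; auto).
  (* The range starts at [-1] so that a move across the near boundary is included. *)
  assert (Hstep1 : forall x, -1 <= x -> collapse g1 h1 (x + 1) = collapse g1 h1 x \/
                      collapse g1 h1 (x + 1) = collapse g1 h1 x + 1).
  { intros x Hx. destruct (Z.eq_dec x (-1)) as [->|].
    - simpl Z.add. rewrite collapse_0, collapse_opp1; auto.
    - apply collapse_step; auto; lia. }
  assert (Hstep2 : forall x, -1 <= x -> collapse g2 h2 (x + 1) = collapse g2 h2 x \/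
                      collapse g2 h2 (x + 1) = collapse g2 h2 x + 1).
  { intros x Hx. destruct (Z.eq_dec x (-1)) as [->|].
    - simpl Z.add. rewrite collapse_0, collapse_opp1; auto.
    - apply collapse_step; auto; lia. }
  assert (Hmove : forall p d, in_grid m' n' p ->
            (f (shift p d 1) = f p \/ f (shift p d 1) = shift (f p) d 1) /\
            (in_grid m n (f (shift p d 1)) -> in_grid m' n' (shift p d 1))).
  { intros [x y] d [Hx Hy]; simpl in Hx, Hy. unfold f, in_grid, shift. simpl fst; simpl snd.
    destruct d; simpl fst; simpl snd; rewrite ?Z.mul_0_r, ?Z.add_0_r, ?Z.mul_1_r;
      change (1 * -1) with (-1); split.
    - destruct (Hstep1 (x - 1)) as [E|E]; [lia| |]; replace (x - 1 + 1) with x in E by lia;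
        replace (x + -1) with (x - 1) by lia; [left|right]; f_equal; lia.
    - intros G. enough (x <> 0) by lia. intros ->. simpl Z.add in G. rewrite collapse_opp1 in G; auto. lia.
    - destruct (Hstep1 x) as [E|E]; [lia| |]; [left|right]; f_equal; lia.
    - intros G. enough (x + 1 <> m') by lia. intros E. rewrite E, Hout1 in G. lia.
    - destruct (Hstep2 y) as [E|E]; [lia| |]; [left|right]; f_equal; lia.
    - intros G. enough (y + 1 <> n') by lia. intros E. rewrite E, Hout2 in G. lia.
    - destruct (Hstep2 (y - 1)) as [E|E]; [lia| |]; replace (y - 1 + 1) with y in E by lia;
        replace (y + -1) with (y - 1) by lia; [left|right]; f_equal; lia.
    - intros G. enough (y <> 0) by lia. intros ->. simpl Z.add in G. rewrite collapse_opp1 in G; auto. lia. }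
  assert (HBg : forall i, (i < 3)%nat -> in_grid m n (s i)).
  { intros i Hi. rewrite <- Hfs by auto. apply Hgrid, HB; auto. }
  assert (Hreach : forall i q d, (i < 3)%nat -> reach m n s L i q d ->
    forall p, in_grid m' n' p -> f p = q -> reach m' n' s' L' i p d).
  { intros i q d Hi. induction 1 as [d|q d G B Hr IH]; intros p Hp Ep.
    - apply Hsink in Ep as ->; auto. constructor.
    - set (d1 := new_dir L i q d) in *.
      (* Inner induction for the time spent over one cell [q]. By [new_dir_idem] meeting the same
         arrow again changes nothing, so the packet keeps direction [d1] and its distance to that
         side decreases until the image moves on. *)
      assert (Hloop : forall N p d0, in_grid m' n' p -> f p = q -> new_dir L i q d0 = d1 ->
                (Z.to_nat (dist_to_side m' n' p d1) < N)%nat -> reach m' n' s' L' i p d0).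
      { clear p Hp Ep. induction N as [|N IHN]; intros p d0 Hp Ep Ed HN; [lia|].
        apply reach_step; auto.
        - apply Hblank. now rewrite Ep.
        - rewrite Hnew, Ep, Ed by auto. destruct (Hmove p d1 Hp) as [[E|E] Hin]; rewrite Ep in E.
          + assert (Hp1 : in_grid m' n' (shift p d1 1)) by (apply Hin; now rewrite E).
            apply IHN; auto.
            * unfold d1. apply new_dir_idem.
            * rewrite dist_shift. rewrite in_grid_dist in Hp1. specialize (Hp1 d1).
              rewrite dist_shift in Hp1. lia.
          + apply IH; auto. apply Hin. rewrite E.
            apply reach_sink_or_blank in Hr as [->|[]]; auto. }
      apply (Hloop (S (Z.to_nat (dist_to_side m' n' p d1)))); auto. }
  exists L'. split.
  - intros p i d E. unfold L' in E. destruct (in_gridb m' n' p) eqn:G; [|discriminate].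
    apply HL in E as [_ [B Hi]]. split; [now apply in_gridb_true|auto].
  - intros i Hi p d He. apply succeeds_reach.
    apply entry_dist in He as [Hp Hd]; auto.
    apply (Hreach i (f p)); auto. apply perfect_reach; auto.
    pose proof (Hgrid p Hp) as Hfp. apply entry_dist; unfold in_grid in Hfp; [lia|lia|].
    split; [auto|]. unfold f. destruct d; simpl in Hd |- *.
    + replace (fst p) with (axis_length h1 - 1) by (fold m'; lia). rewrite collapse_last; auto. fold m; lia.
    + rewrite Hd. apply collapse_0; auto.
    + rewrite Hd. apply collapse_0; auto.
    + replace (snd p) with (axis_length h2 - 1) by (fold n'; lia). rewrite collapse_last; auto. fold n; lia.
Qed.

(** * Drawn layouts *)

(* Colours 0, 1 and 2 are drawn as lower case initials, upper case initials and arrow heads;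
   digits mark the sinks for the reader only. *)
Definition arrow_of_char (a : ascii) : option (nat * dir) :=
  match a with
  | "n" => Some (0%nat, DN) | "s" => Some (0%nat, DS)
  | "e" => Some (0%nat, DE) | "w" => Some (0%nat, DW)
  | "N" => Some (1%nat, DN) | "S" => Some (1%nat, DS)
  | "E" => Some (1%nat, DE) | "W" => Some (1%nat, DW)
  | "^" => Some (2%nat, DN) | "v" => Some (2%nat, DS)
  | ">" => Some (2%nat, DE) | "<" => Some (2%nat, DW)
  | _ => None
  end%char.

(** The guards make every drawing a valid layout, whatever is written on the sinks, so that only the
    journeys remain to be computed. *)
Definition drawn_layout (m n : Z) (sink : nat -> cell) (rows : list string) : layout :=
  fun p =>
    if in_gridb m n p && negb (is_sinkb sink p) then
      match nth_error rows (Z.to_nat (fst p)) with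
      | Some row =>
          match String.get (Z.to_nat (snd p)) row with
          | Some a => arrow_of_char a
          | None => None
          end
      | None => None
      end
    else None.

Lemma drawn_layout_valid m n sink rows : valid_layout m n sink (drawn_layout m n sink rows).
Proof.
  intros p i d. unfold drawn_layout.
  destruct (in_gridb m n p) eqn:G; [|discriminate]. apply in_gridb_true in G.
  destruct (is_sinkb sink p); [discriminate|]. simpl.
  destruct (nth_error rows _) as [row|]; [|discriminate].
  destruct (String.get _ row) as [a|]; [|discriminate].
  intros E. repeat split; try apply G.
  destruct a as [[] [] [] [] [] [] [] []]; simpl in E; try discriminate;
    injection E as <- _; auto with arith.
Qed.

Fixpoint reachb (m n : Z) (sink : nat -> cell) (L : layout) (i fuel : nat) (p : cell) (d : dir) : bool :=
  if cell_eqb (sink i) p then true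
  else match fuel with
  | O => false
  | S fuel' =>
      if in_gridb m n p && negb (is_sinkb sink p) then
        let d' := new_dir L i p d in reachb m n sink L i fuel' (shift p d' 1) d'
      else false
  end.

Lemma reachb_reach m n sink L i fuel p d :
  reachb m n sink L i fuel p d = true -> reach m n sink L i p d.
Proof.
  revert p d; induction fuel as [|fuel IH]; intros p d; simpl;
    destruct (cell_eqb (sink i) p) eqn:E;
    try (intros _; unfold cell_eqb in E; rewrite andb_true_iff, !Z.eqb_eq in E;
         replace p with (sink i) by (apply injective_projections; apply E); constructor);
    [discriminate|].
  destruct (in_gridb m n p) eqn:G, (is_sinkb sink p) eqn:B; simpl; try discriminate.
  intros H. apply reach_step; auto. now apply in_gridb_true.
Qed.

Definition entries (m n : Z) : list (cell * dir) :=
  flat_map (fun r => [((r, 0), DE); ((r, n - 1), DW)]) (zrange m) ++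
  flat_map (fun c => [((0, c), DS); ((m - 1, c), DN)]) (zrange n).

Lemma in_entries m n p d : entry m n p d -> In (p, d) (entries m n).
Proof.
  destruct p as [r c]. unfold entries. rewrite in_app_iff, !in_flat_map.
  intros [[-> [E H]]|[[-> [E H]]|[[-> [E H]]|[-> [E H]]]]]; simpl in E, H; subst;
    [left; exists r|left; exists r|right; exists c|right; exists c];
    rewrite in_zrange; simpl; auto.
Qed.

(** The bound of 200 steps carries no proof obligation: running out of fuel makes the test fail, and
    the drawings below pass it. *)
Definition perfectb (m n : Z) (sink : nat -> cell) (rows : list string) : bool :=
  let L := drawn_layout m n sink rows in
  forallb (fun i => forallb (fun e => reachb m n sink L i 200 (fst e) (snd e)) (entries m n))
    [0; 1; 2]%nat.

Lemma perfectb_perfect m n sink rows :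
  perfectb m n sink rows = true -> has_perfect_layout m n sink.
Proof.
  intros H. exists (drawn_layout m n sink rows). split; [apply drawn_layout_valid|].
  intros i Hi p d He. apply succeeds_reach.
  unfold perfectb in H. rewrite forallb_forall in H.
  assert (Hin : In i [0; 1; 2]%nat) by (simpl; lia).
  specialize (H i Hin). rewrite forallb_forall in H.
  apply in_entries in He. apply (H _) in He. eapply reachb_reach; eauto.
Qed.

(** * Reduction to finitely many boards *)

Definition gap_leb (a b : Z) : bool := (0 <=? a) && (a <=? b) && ((negb (a =? 0)) || (b =? 0)).

Fixpoint gaps_leb (g h : list Z) : bool :=
  match g, h with
  | [], [] => true
  | a :: g', b :: h' => gap_leb a b && gaps_leb g' h'
  | _, _ => false
  end.

Lemma gaps_leb_le g h : gaps_leb g h = true -> Forall2 gap_le g h.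
Proof.
  revert h; induction g as [|a g IH]; intros [|b h]; simpl; try discriminate; [constructor|].
  intros H. apply andb_true_iff in H as [H1 H2]. constructor; auto.
  unfold gap_leb in H1; unfold gap_le; lia.
Qed.

Definition drawing : Type := list Z * list Z * list string.

Definition drawing_ok (pat : nat -> nat * nat) (e : drawing) : bool :=
  let '(g, h, rows) := e in perfectb (axis_length g) (axis_length h) (gap_sink pat g h) rows.

Definition covered (db : list drawing) (g h : list Z) : bool :=
  existsb (fun e : drawing => let '(g0, h0, _) := e in gaps_leb g0 g && gaps_leb h0 h) db.

Fixpoint box (l : list (Z * Z)) : list (list Z) :=
  match l with
  | [] => [[]]
  | (a, b) :: l' => flat_map (fun x => map (cons (a + x)) (box l')) (zrange (b - a + 1))
  end.

Fixpoint clamp (l : list (Z * Z)) (g : list Z) : list Z :=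
  match l, g with
  | (_, b) :: l', x :: g' => Z.min x b :: clamp l' g'
  | _, _ => []
  end.

(** The cap [snd r] is positive so that truncation never empties a nonempty gap, as [gap_le]
    demands. *)
Definition in_range (r : Z * Z) (x : Z) : Prop := 0 <= fst r <= x /\ fst r <= snd r /\ 0 < snd r.

Lemma clamp_in_box l g : Forall2 in_range l g -> In (clamp l g) (box l).
Proof.
  induction 1 as [|[a b] x l g Hx _ IH]; [now left|]. unfold in_range in Hx; simpl in *.
  apply in_flat_map. exists (Z.min x b - a). rewrite in_zrange. split; [lia|].
  replace (a + (Z.min x b - a)) with (Z.min x b) by lia. now apply in_map.
Qed.

Lemma clamp_le l g : Forall2 in_range l g -> Forall2 gap_le (clamp l g) g.
Proof.
  induction 1 as [|[a b] x l g Hx _ IH]; simpl; constructor; auto.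
  unfold in_range, gap_le in *; simpl in *; lia.
Qed.

Lemma gap_le_trans g h k : Forall2 gap_le g h -> Forall2 gap_le h k -> Forall2 gap_le g k.
Proof.
  intros H; revert k; induction H as [|a b g h Hab H IH]; intros k Hk; inversion Hk; subst;
    constructor; auto. unfold gap_le in *; lia.
Qed.

Definition all_covered (db : list drawing) (ok : list Z -> list Z -> bool)
    (l1 l2 : list (Z * Z)) : bool :=
  forallb (fun g => forallb (fun h => implb (ok g h) (covered db g h)) (box l2)) (box l1).

(** Two comparisons are chained: a drawn board lies below the truncated board by the finite check,
    and the truncated board lies below the given one. For this [ok] is only evaluated on truncated
    gaps. *)
Lemma covered_perfect pat db ok l1 l2 g h :
  forallb (drawing_ok pat) db = true -> all_covered db ok l1 l2 = true ->
  Forall2 in_range l1 g -> Forall2 in_range l2 h -> ok (clamp l1 g) (clamp l2 h) = true ->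
  (forall i, (i < 3)%nat -> (fst (pat i) < length g)%nat /\ (snd (pat i) < length h)%nat) ->
  valid_board (axis_length g) (axis_length h) (gap_sink pat g h) ->
  has_perfect_layout (axis_length g) (axis_length h) (gap_sink pat g h).
Proof.
  intros Hdb Hcov Hg Hh Hok Hpat HB.
  unfold all_covered in Hcov. rewrite forallb_forall in Hcov.
  specialize (Hcov _ (clamp_in_box _ _ Hg)). rewrite forallb_forall in Hcov.
  specialize (Hcov _ (clamp_in_box _ _ Hh)). rewrite Hok in Hcov.
  apply existsb_exists in Hcov as [[[g0 h0] rows] [Hin Hle]].
  apply andb_true_iff in Hle as [Hg0 Hh0]. apply gaps_leb_le in Hg0, Hh0.
  assert (Hg' : Forall2 gap_le g0 g) by (eapply gap_le_trans; eauto using clamp_le).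
  assert (Hh' : Forall2 gap_le h0 h) by (eapply gap_le_trans; eauto using clamp_le).
  apply (stretch_perfect pat g0 h0 g h); auto.
  - rewrite (Forall2_length Hg'), (Forall2_length Hh'). auto.
  - rewrite forallb_forall in Hdb. apply Hdb in Hin. exact (perfectb_perfect _ _ _ rows Hin).
Qed.

(** * The minimal boards *)

(* Each entry lists the row gaps, the column gaps and the drawing of a minimal board; the
   layouts were found by a SAT solver. The digits in the names count the rows and the columns
   with sinks. *)
Local Open Scope string_scope.

Definition layouts13 : list drawing := [
  (([2; 2], [2; 1; 1; 4]),
   ["evEEeSW<sWw"; "EE>N>eeeesv"; "Nv0w1W2n<N<"; "n>>>w>wES>^"; ">eEn>NW^WwW"]);
  (([2; 2], [2; 1; 2; 3]),
   ["EEES>vsw<w<"; ">>>swEwEES^"; "^N0w1>W2s<S"; "eeEEeeNW^nw"; "nN>>>^<wwWW"]);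
  (([2; 2], [2; 1; 3; 2]),
   ["sEE>w>vww<S"; "Es>E>^ESWW<"; "Nv0w1W>W2Ns"; ">eE^eeenENW"; "e>>n>N^<www"]);
  (([2; 2], [2; 2; 0; 4]),
   ["Se>vW<ee<<s"; "EnES>wW>wwv"; "Nv0Ew12ESn<"; ">EEenwEN^Ww"; "e>>>N>e^WnW"]);
  (([2; 2], [2; 2; 1; 3]),
   ["Ee>sv<Sw<wW"; "eEE>>eSWsWv"; "vN0Ew1W2S<s"; "v<ENWe<eenw"; ">N>en>wWW^<"]);
  (([2; 2], [2; 2; 2; 2]),
   ["eE>>>>veEsS"; ">eEEswSvwWw"; "^N0ww1>W2Nn"; "Ev<nEwwNw<W"; "N>Wn^<W<Ww<"]);
  (([2; 2], [2; 3; 0; 3]),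
   ["eS>>WswWv<<"; ">EEes>>wvwS"; "Sv0EwE12<Ss"; "^e<nNwwWwWw"; "E>EN>n>wW^W"]);
  (([2; 2], [2; 3; 1; 2]),
   [">eEesS>vWWw"; "E>>>SveWe<n"; "N^0EwE1>2Nn"; "^EEn<<wwwN<"; "eN>^We<nWwW"]);
  (([2; 2], [3; 0; 1; 4]),
   ["vSW<<sWwW<W"; "sE>Ew>wSvww"; "eN^01W2n<EN"; ">>^<<NeWen<"; "EeeEeeE>n^N"]);
  (([2; 2], [3; 0; 2; 3]),
   ["vsSW<wwwW<w"; ">S>>evnWwWW"; "^eS01>W2nwN"; "e>EEe^<E<Nn"; "EEe>>ENe^n<"]);
  (([2; 2], [3; 0; 3; 2]),
   ["sw>EwvwSw<w"; "v<S<<sWwWW<"; "e^S01>>W2sS"; ">EE>>E^NWsW"; "E^eEeen<wwN"]);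
  (([2; 2], [3; 1; 0; 4]),
   ["EsvESwWWWw<"; "s>w>v<w<NWw"; "e^S0E12sN<W"; ">EEE>>EswN^"; "Ne>>eeee>^n"]);
  (([2; 2], [3; 1; 1; 3]),
   ["s>EEwwSwvW<"; ">sN>v<wWwwW"; "^eN0E1>2<Ns"; "E^<E<<EES<s"; "eEe>Ne^eWnw"]);
  (([2; 2], [3; 1; 2; 2]),
   [">EE>>evSWsW"; "EesE^<E<wwN"; "eNv0w1>W2Ss"; "^Ne<WeswW<<"; "n>>E^<wNwWw"]);
  (([2; 2], [3; 2; 0; 3]),
   ["EswESwwWW>v"; "v<E<ES<e<es"; "Nev0wE12Nn<"; "eE>E>n>wN^W"; ">n^<N<wWwWw"]);
  (([2; 2], [3; 2; 1; 2]),
   ["SeWW>eevWsW"; ">Ss>w>>wwWv"; "^Se0EE1>2Ns"; "eENWn^wWwww"; "E>>>nN>^W<<"]);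
  (([2; 2], [4; 0; 1; 3]),
   ["swES>wwwvwW"; "vENsW<<W<Ww"; "EvNe01W2sN<"; "e>>>EeNWevn"; ">nwE>>NwW>^"]);
  (([2; 2], [4; 0; 2; 2]),
   [">sEEEwSvwwW"; "^Esw<<<SW<w"; "eveN01W>2nN"; "Se>nWw^wwW<"; "E>N>>>eWW^n"]);
  (([2; 2], [4; 1; 0; 3]),
   ["veSsWw<W<WW"; "eS>s>vwww<w"; "ES^e0E12nN<"; "vEe<<N<eWen"; ">>EEE>eENn^"]);
  (([2; 2], [4; 1; 1; 2]),
   ["e>sSWw>vwwW"; ">EEE>SeWWnv"; "Seve0E1>2nN"; "Snw>>>w^W<w"; "EN>^Wn<wwW<"]);
  (([2; 3], [2; 0; 0; 4]),
   ["Sv<<WWsSW"; "EeEee>sSv"; "vS012s<wN"; ">EEeE^Snw"; "NvnNwwwW<"; "e>>>^NW<n"]);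
  (([2; 3], [2; 0; 1; 3]),
   [">sE>vw<Sw"; "EE>esESWv"; "^N01>2EsS"; "Nv<esWWw<"; "swE>w^N<<"; "e>nNWww^W"]);
  (([2; 3], [2; 0; 2; 2]),
   ["v<EesSWes"; ">S>>svwWW"; "S^01es2nN"; "SW>en>Wv<"; "e^E<<eenN"; "EenNWW^<w"]);
  (([2; 3], [2; 1; 0; 3]),
   ["eS>swWWvW"; "n>E>>wwSv"; "S^0w12NSs"; "veEENesww"; "EEnN>^w<<"; ">n>^wE<EN"]);
  (([2; 3], [2; 1; 1; 2]),
   ["vs<EwEEES"; "EvES<swww"; "Nv0E1>2Nn"; ">EEvesEN<"; "Ne>eWs^<W"; "e>n>>ww^N"]);
  (([2; 3], [2; 2; 0; 2]),
   ["eS>e>eWvs"; "SvW<s<www"; "Sv0Ew12nS"; "EeEnEN^<<"; ">E>n^<wSW"; "N>^^<eWWn"]);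
  (([2; 3], [3; 0; 0; 3]),
   ["svSW<Ww<w"; "vE<>een^S"; "veS012Ss<"; "EnEvNWW<W"; ">nwE>wNw^"; "e>^<en<EN"]);
  (([2; 3], [3; 0; 1; 2]),
   ["SveWeeWWs"; "s>v<<SwwW"; "vS<01W2Ns"; "EEE>>NWvs"; "e^<nN<^<w"; ">eNWenw^<"]);
  (([2; 3], [3; 1; 0; 2]),
   ["esw>SwwvW"; "vESWe<W<s"; "Sev0E12Ss"; "En>EE>^^N"; ">>nvNwwWw"; "NnW>>^Ww<"]);
  (([2; 3], [4; 0; 0; 2]),
   [">>vs<<EES"; "ESWvWee<s"; "N^ee012Ns"; "esN>vwWwW"; "nE>SW>^N<"; "^enE<NwNw"]);
  (([2; 4], [2; 0; 0; 2]),
   ["vsEwE<S"; "Ss>>w^<"; "vS012Ss"; ">EnvwES"; "e>S>^sw"; "EN>eWs^"; "^eENnwW"]);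
  (([2; 4], [2; 0; 1; 2]),
   ["ev<<EesS"; "nvEwNW<w"; "vS01>2Sn"; "EEn>wS^<"; "E>>sN^w^"; ">sEN^wWW"; "Nenw^W-W"]);
  (([2; 4], [2; 1; 0; 2]),
   ["e>ESeesv"; "EE>s>ESv"; "N^0w12Ss"; ">e>vNsW<"; "v<nSwWww"; "v^E<<enS"; ">NnWW^<W"]);
  (([3; 2], [2; 0; 0; 4]),
   ["swE>Svw<W"; "eEsSwEE^N"; "E>>eE>Ssv"; "vN012s<S<"; "nN>ww^Www"; ">NW>We^Wn"]);
  (([3; 2], [2; 0; 1; 3]),
   ["EE>s>v<Sw"; "e>swSW^<n"; ">^E>SeWsv"; "N^01W2eSn"; "^s<wwwNW<"; "NeW>^WnwW"]);
  (([3; 2], [2; 0; 2; 2]),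
   ["esE>>wvES"; ">es^wnEN<"; "nv<wSWw<W"; "^S01W>2Ss"; "n>>w^NwWw"; "EEE>^NWen"]);
  (([3; 2], [2; 1; 0; 3]),
   [">EvESsWWW"; "E>EN>Wevs"; "e^<seenN<"; "^N0w12n<N"; "N^W<eWnws"; "nw>^<w<Nw"]);
  (([3; 2], [2; 1; 1; 2]),
   ["SWWs>wWvw"; ">sNvwvwW<"; "ev<ESWn<W"; "^N0w1>2sN"; "^>E>eNes^"; "Ee>^<nEwN"]);
  (([3; 2], [2; 2; 0; 2]),
   ["Ee>Sswwv<"; "sESvs<W<w"; ">>ES>nvWW"; "N^0Ew12sN"; "eN>>^>e^n"; "^NWeWeWen"]);
  (([3; 2], [3; 0; 0; 3]),
   ["e>sE>wvwS"; "nwEvSWwW<"; "SWv<eWn<w"; "vNe012<nS"; ">^<E<enNW"; "En^<wEE^N"]);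
  (([3; 2], [3; 0; 1; 2]),
   [">EeEesESv"; "Evv<<Sesv"; "eeEsSwv<<"; "^<N01W2Ss"; "Nn>WwvwWw"; "^nN<<<WwW"]);
  (([3; 2], [3; 1; 0; 2]),
   [">Se>v<esW"; "SeWswevs<"; "EvnE>SW>^"; "^S<0E12sN"; "e>^<n<wEN"; "nE^ENwWww"]);
  (([3; 2], [4; 0; 0; 2]),
   ["v<<sESWWw"; "eSsW>wv<W"; "Ssw>^<wen"; ">eS^012Nn"; "ESn^<wwN<"; "nEEwE>EN^"]);
  (([3; 3], [2; 0; 0; 2]),
   [">S>evs<"; "s>ESWW^"; "^Es<wNw"; "S^012sS"; "es>>EvS"; "EeSe^<n"; "n^ENwwW"]);
  (([3; 3], [2; 0; 1; 2]),
   [">vEeswES"; "^ssS<W<w"; "s>>>svwS"; "^S01W2nS"; "e>EveENn"; "EevenwN<"; "^E<<NnnW"]);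
  (([3; 3], [2; 1; 0; 2]),
   ["ve<S<v<s"; "EvE>Se^s"; "vSs^wWWw"; "vS0w12Nn"; "e>E^eSs<"; "NWvn<WwW"; ">e>ENen^"]);
  (([4; 2], [2; 0; 0; 2]),
   ["ESsww>v"; ">vE<nSW"; "sE>SvW<"; "eNs^Www"; "^N012nN"; "nwE>EN^"; "n>>ww^N"]);
  (([4; 2], [2; 0; 1; 2]),
   ["EE>>vsS<"; "eN^e-e<s"; ">eESevs<"; "eNsSvWWW"; "^N01W2Ns"; "nv<wNwww"; "N>W>>Wn^"]);
  (([4; 2], [2; 1; 0; 2]),
   ["v<>SswvW"; ">sSW>v<<"; "eEswwE^N"; "^eEnS-Ws"; "S^0w12sN"; "S^<<eees"; "EnE^<ENw"])
].

Definition layouts22 : list drawing := [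
  (([2; 0; 2], [2; 1; 4]),
   ["SeW>ev>sv"; "EE>v<eSsw"; "Nv0w1vWWn"; "Nn2n<<wNW"; "e>e>NW^<n"; ">NWWe^nw<"]);
  (([2; 0; 2], [2; 2; 3]),
   ["SvWW<<esW"; "ee>s^wSWw"; "Sv0wE1ven"; "Sn2eNenw<"; "E>EnwN>>^"; ">Ee>^<EnN"]);
  (([2; 0; 2], [2; 3; 2]),
   ["esEwsv<S<"; "nE>>SWwW^"; "Sv0EEw1s^"; "Ss2Ne<swW"; ">ee^nN<<w"; "E>EE>nw^N"]);
  (([2; 0; 2], [3; 0; 4]),
   ["EesEwSWvw"; "eEv<<E<sS"; "vNe01vsWW"; ">nS2s<wN<"; "Nv<W>e^<n"; "N>Wee^<en"]);
  (([2; 0; 2], [3; 1; 3]),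
   ["vE<<S<s<W"; "EvsESwwWw"; "eN^0E1W^n"; "nNw2Ns<w<"; "eeEee>Nn^"; ">>nE>w^^N"]);
  (([2; 0; 2], [3; 2; 2]),
   ["EesEv<<Sw"; ">v<<<SesW"; "^ES0wE1vn"; "N>s2nNww<"; "eNeWnNv<n"; "^nEwEw<EN"]);
  (([2; 0; 2], [4; 0; 3]),
   ["v<S<<<s<<"; "SevsWwWww"; "e^<S01s^W"; ">nSs2e<Sn"; "nEEwe>^Sn"; "E^eEEnwEN"]);
  (([2; 0; 2], [4; 1; 2]),
   ["E>svESwwW"; "vsEw<<<EN"; "N^eW0E1nv"; "Ns->2Ns<w"; "eEvNWe<n<"; ">e>^eNen^"]);
  (([2; 0; 2], [5; 0; 2]),
   [">EvEs<<Sw"; "evs<<Ew<S"; "EveeS01sv"; "Ns>WS2<sS"; "nwE^EENwW"; "^<nNwwwW<"]);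
  (([2; 0; 3], [2; 1; 2]),
   ["SW>swvw"; "eNWs>wv"; "vN0w1nv"; "Ss2<s<S"; "S>^n<W<"; ">eEnw^S"; "E^eENnW"]);
  (([2; 0; 3], [3; 0; 2]),
   ["svw<<wS"; "esvEwS<"; "veS01vs"; ">nS2Nnw"; "^E<s<<S"; "S>^WenW"; "EnEwNW^"]);
  (([2; 1; 2], [2; 0; 3]),
   ["ESWesWv"; "vE<<Ssw"; "Nv01>vn"; "N>nww>v"; "Ns2<nN<"; ">swN^wW"; "eeEnE^N"]);
  (([2; 1; 2], [2; 1; 2]),
   ["sEESwv<"; ">e>s>S^"; "^N0E1s^"; "evnwNWw"; "Sn2<<Nn"; "EnE^N<W"; "N>enww^"]);
  (([2; 1; 2], [3; 0; 2]),
   ["SWv<e<s"; "v<sE<wS"; "e^S01^s"; "EswvNW<"; "nN>2sNw"; ">e^E<Nn"; "n^EwwNW"]);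
  (([2; 1; 4], [2; 0; 2]),
   ["SeW>vs"; "sv<wSw"; "vS01sv"; "eSnwvW"; "nS2<sN"; "n>wNWv"; "vEn^N<"; "E^Sn<<"; ">^EnwN"]);
  (([2; 2; 3], [2; 0; 2]),
   ["SvW<sw"; "vS<esn"; "vS01sv"; ">evsSW"; "SWn-wv"; "Sn2NWn"; "EvENn<"; "eve<nN"; "^<Ne<n"]);
  (([2; 3; 2], [2; 0; 2]),
   ["sv<<SS"; "veEesS"; "vS01vs"; "EnvN<W"; ">Snw^<"; "^vnNww"; "Nn2nEN"; "eEEvNn"; "n>w>^N"]);
  (([3; 0; 2], [2; 0; 3]),
   ["Eesw>Sv"; "eE>nSWv"; ">vE<sNw"; "Nv01^en"; "nN2NWn<"; "Nnw>wvW"; "N>We^<n"]);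
  (([3; 0; 2], [2; 1; 2]),
   ["e>EsSvw"; "SesW>wv"; "vS<<eWn"; "vS0w1nv"; "Sn2N<n<"; "ESe^enW"; ">EEnN>^"]);
  (([3; 0; 2], [3; 0; 2]),
   ["Es>>>Sv"; "vsEESwW"; "vSeswW<"; "v<N01n^"; "sEN2N<s"; ">enww^N"; "eNnW>^w"]);
  (([3; 0; 4], [2; 0; 2]),
   ["S>s>vw"; "s^EeSn"; ">e>^sS"; "^S01vn"; "sS2NWn"; "s^^N<W"; "EEsvN<"; "enwwN^"; "^NW<en"]);
  (([3; 1; 3], [2; 0; 2]),
   ["EvESs<"; "sv<<SS"; ">vswwS"; "^S01vs"; "evn<Sw"; "nS2s<S"; "nww^ES"; "E>EN^n"; "nENw^W"]);
  (([3; 2; 2], [2; 0; 2]),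
   ["Ev<s<S"; "vEE<Ss"; "Ne^eWs"; "Nv01^s"; "Nnn>^w"; ">vnNwW"; "sN2<nN"; "^nwwN<"; "e>E^nN"]);
  (([4; 0; 3], [2; 0; 2]),
   ["vSW<sW"; "vEsSwv"; "vsNwWw"; "Sv<^<n"; "Sv01nv"; "Ss2Nn<"; "ees>N^"; ">NWen^"; "E>en^N"]);
  (([4; 1; 2], [2; 0; 2]),
   ["sEvSsW"; "vNWes<"; "vNsnWw"; ">v<<Nn"; "^N01vn"; "EvnwwN"; "Ns2<Nn"; "eeENvn"; "n>w^<N"]);
  (([5; 0; 2], [2; 0; 2]),
   ["EesvSW"; "N>vees"; "eEESvs"; "-nNvw<"; "vN<<Ws"; "vN01n^"; "nN2s<N"; ">nE>^N"; "^Neenw"])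
].

Definition layouts23a : list drawing := [
  (([2; 0; 2], [2; 0; 0; 4]),
   ["ee>eeSvsW"; "SWW>W>Wsv"; "vN01vWsW<"; ">N>s2N<sw"; "SnWwWwsw^"; "E>n>wNw>^"]);
  (([2; 0; 2], [2; 0; 1; 3]),
   ["EEE>veesS"; "sw>w>ESvW"; "Nv01WvWWs"; "sn>>N2n<N"; "evEsNW<w<"; ">>nwwwN^w"]);
  (([2; 0; 2], [2; 0; 2; 2]),
   ["Ss>wwwwv<"; "s>E>S>W>v"; "vS01vWnww"; "Es>w>N2nS"; ">en>^NWWW"; "eEE^EnwN<"]);
  (([2; 0; 2], [2; 1; 0; 3]),
   ["EvEs<w<Sw"; "sv<EwSWW<"; "vS0w1W^<n"; ">e>nN2eNn"; "^<ENeWnw<"; "eE^<<eNnW"]);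
  (([2; 0; 2], [2; 1; 1; 2]),
   ["EsES>vw<w"; "NW>veeWWn"; "Nv0E1>ven"; "sw>esS2nS"; ">>ENe^Wn<"; "e^n<<EwNW"]);
  (([2; 0; 2], [2; 2; 0; 2]),
   [">s>>S>vW<"; "^EEs<wEwS"; "^N0Ew1en^"; "E>EenN2nS"; "eeN^WeenW"; "^n<wN<W<w"]);
  (([2; 0; 2], [3; 0; 0; 3]),
   ["veE<eEesS"; "ensE>vSWw"; "vSe01eWvn"; "Sn>W>2Nen"; "E>NveW<n<"; ">En>^wN<W"]);
  (([2; 0; 2], [3; 0; 1; 2]),
   ["sESW>vw<w"; ">sv<wwES<"; "evS01vn-W"; "n>>ENW2sN"; "^eENe<Wen"; "Enw>>^wEN"]);
  (([2; 0; 2], [3; 1; 0; 2]),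
   ["veEEswwSW"; ">Ss>v<SWw"; "S>v0w1Wsv"; "eS>Wn>2Nn"; "n^wNWwWw<"; "EE^<<nw<N"]);
  (([2; 0; 2], [4; 0; 0; 2]),
   [">S>s>>WvW"; "Es^EEwwS<"; "N>^e01vWs"; "Nee>n>2sN"; "enS^Wwwww"; "NWW^<nE<N"]);
  (([2; 0; 3], [2; 0; 0; 3]),
   ["vEEeSs<<"; "S>>>evWs"; "vN01Wves"; "eN>s2sNw"; "E^Ee-EnS"; ">Nn>WwvW"; "nw^Nw<<w"]);
  (([2; 0; 3], [2; 0; 1; 2]),
   ["Ev<<swSW"; "swEwwSvW"; "Nv01vWsw"; "N>>sW2sN"; "s^E<nSw<"; ">E^s<wEN"; "eNne^W<n"]);
  (([2; 0; 3], [2; 1; 0; 2]),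
   ["eS>>>esv"; "n>E^wESw"; "S^0E1nWv"; "Sensw2sS"; ">nEw>^<S"; "eS>n^wwW"; "EEnN^Wn<"]);
  (([2; 0; 3], [3; 0; 0; 2]),
   ["vsSW<wWw"; "e>s>wvNW"; "-^S01Wsv"; ">S>n>2Nn"; "nw^EeEsN"; "E^enNw<<"; "NWW>^nw^"]);
  (([2; 0; 4], [2; 0; 0; 2]),
   ["esE>wSv"; "v>>evsS"; "S^01Wvs"; "nSEN2sS"; "ESnvw<w"; ">EvsSWW"; "N^<enw<"; "^eN<Wn^"]);
  (([2; 1; 2], [2; 0; 0; 3]),
   ["eE>eS-sv"; "vsE<EwwS"; "vN01eWvs"; "ven<N<Ww"; "S>n-2N<n"; "EN>ee^n<"; ">NWNWn^W"]);
  (([2; 1; 2], [2; 0; 1; 2]),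
   ["vE<<<ESs"; "S>WeWvsw"; "vN01evWn"; "vN<s-wwW"; "EeSsN2Nn"; "eNnw^w<<"; ">^E>nEN^"]);
  (([2; 1; 2], [2; 1; 0; 2]),
   ["SvW<<esW"; "Ee>swvS<"; "Nv0w1Wvs"; "eEE^<N<s"; ">nNW-2Ss"; "^<ENeWWs"; "^N<n-www"]);
  (([2; 1; 2], [2; 1; 1; 2]),
   ["s>>s>wEvS"; ">^EveENWs"; "Sv0w1nvW<"; "E>vSenwwW"; "esSW>n2nN"; "Ne>>^nw>^"; "^EEnN<W<w"]);
  (([2; 1; 2], [3; 0; 0; 2]),
   ["v<<EeS<s"; ">Es>>vSS"; "^NW01Wsv"; "^NsWNwWw"; "EsN>w2sS"; "s-^N<wwW"; "eeenNW^<"]);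
  (([2; 1; 3], [2; 0; 0; 2]),
   ["Ss>>esv"; "S>Wev<s"; "vS01Wsv"; "veENnWs"; ">ENs2Ns"; "eNvesw<"; "^n<NWww"; "ENn>w^W"]);
  (([2; 2; 2], [2; 0; 0; 2]),
   ["Ss>wwvw"; "sEE>vS<"; "vN01Ws^"; "EsnwNW^"; "sNW>wvW"; "e>nN2sN"; "N^<nw<w"; ">e^NWen"]);
  (([3; 0; 2], [2; 0; 0; 3]),
   [">>>eesSv"; "E^s>vwwS"; "sEESvWW<"; "N^01W>n^"; "esEN2Nns"; "NeN>WnvW"; "^N<een<w"]);
  (([3; 0; 2], [2; 0; 1; 2]),
   [">s>>>vS<"; "^<EeSesW"; "^esSwvWw"; "^S01WWs^"; "EESen2Nn"; "eE>n^w<N"; "-NW>^Wen"]);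
  (([3; 0; 2], [2; 1; 0; 2]),
   [">vS>>sv<"; "Ev<Seees"; "e>EvSWWs"; "N^0E1vnW"; "nw>>N2nN"; "^SWe<W<s"; "NWn-ww^w"]);
  (([3; 0; 2], [3; 0; 0; 2]),
   ["vswE<wSW"; "ev<<eSs<"; ">vEs^ESw"; "vvN01nW^"; "S>n>>2sN"; ">E^nwEwN"; "EeNWnw>^"]);
  (([3; 0; 3], [2; 0; 0; 2]),
   ["eE>S-sv"; "veSes<w"; "SnW>W^<"; "vN01es^"; "nN>>2Sn"; ">>^sSWW"; "^nnEwwN"; "ENWeW^n"]);
  (([3; 1; 2], [2; 0; 0; 2]),
   [">>s>EvS"; "^EESsw<"; "es>w>vS"; "^N01v<s"; "ENWveWs"; "Ns>>2nS"; "^enNenW"; "^nNwW^w"]);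
  (([4; 0; 2], [2; 0; 0; 2]),
   [">v<SWWs"; "EeSeswv"; "eEEnvNW"; "Evs<wNw"; "Nv01nv<"; "nN>>2nN"; "^>EswN^"; "^N^eW<n"])
].

Definition layouts23b : list drawing := [
  (([2; 0; 2], [2; 0; 0; 4]),
   ["EEEE>veSs"; "s>>vwSWww"; "vN0w1evWn"; "sN>2s<<NW"; "eenwwS^<<"; ">^EE<EenN"]);
  (([2; 0; 2], [2; 0; 1; 3]),
   ["ve<E<eSWs"; ">>Esw>vwS"; "^S0wE1>nv"; "EnS2N<Wn<"; "-^EenwN<w"; "eE>ENnw^W"]);
  (([2; 0; 2], [2; 0; 2; 2]),
   ["E>>Ssvw<w"; "veEeSs<W<"; "vS0EwE1s^"; "Nn>2nwwNW"; "eEEEEvNen"; ">^^e<<<nN"]);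
  (([2; 0; 2], [2; 1; 0; 3]),
   ["Ee>SWe>sv"; "eSWsv<W<<"; "Sv0Ew1s^W"; "En>N2eNes"; "v<EeenwEN"; ">En>E>^Nw"]);
  (([2; 0; 2], [2; 1; 1; 2]),
   [">E>EEs>vS"; "swE>vwwwS"; "Sv0wwE1vs"; "eNWn2N<nW"; "E>>^enN<<"; "^nNnW<wWw"]);
  (([2; 0; 2], [2; 2; 0; 2]),
   ["SWWv<e<sW"; ">s>>SWw>v"; "Sv0Een1^s"; "S>>sW2esN"; "e^EeNWnW<"; "EenN^w<ww"]);
  (([2; 0; 2], [3; 0; 0; 3]),
   ["sEwEw>vES"; ">sw>SwwvW"; "^eS0E1nvw"; "En>S2eS<n"; "N>^<Wn<w<"; "eNWWe>Wn^"]);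
  (([2; 0; 2], [3; 0; 1; 2]),
   ["eEe>Ev<sS"; "vesEN<w<w"; ">Nv0wE1^n"; "nN>>2NsWW"; "E>enE^wN<"; "^nEEww<wN"]);
  (([2; 0; 2], [3; 1; 0; 2]),
   [">s>ESW>wv"; "sEw>vNwW<"; "EN^0Ew1n^"; "esSW>2sNW"; "n>E>^E<Nw"; "-eNnwww>^"]);
  (([2; 0; 2], [4; 0; 0; 2]),
   ["veEsESwwW"; "sSwW>W>Wv"; ">vNe0w1vs"; "eS>>n2NWs"; "EEn^<wwNw"; "N>^nWW<<<"]);
  (([2; 0; 3], [2; 0; 0; 3]),
   ["Se>s>vsw"; "v<EEeS<n"; "vS0w1Wsv"; ">Sn2NeWn"; "sn>Swvw<"; "e^EE<nN^"; "EENe^<nW"]);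
  (([2; 0; 3], [2; 0; 1; 2]),
   ["EsEEvw<S"; "sw>v<<Sw"; "vS0wE1sv"; "eSn2NsW<"; "vEE-N<sW"; ">>ve<Nen"; "^n>Eww^N"]);
  (([2; 0; 3], [2; 1; 0; 2]),
   ["EvEswwwS"; "N>>sv<Ww"; "vS0wE1nv"; "ES>n2NnW"; "eESWWsnv"; "veEnw<NW"; ">N^<nw<<"]);
  (([2; 0; 3], [3; 0; 0; 2]),
   ["EsEESwv<"; "eSv<e<Ws"; "Nev0E1vs"; "Nn>W2esS"; ">venw<sS"; "N>^eWn<W"; "^EN<n-ww"]);
  (([2; 0; 4], [2; 0; 0; 2]),
   ["Sv<swWS"; ">vEe<Ns"; "Sv0E1vs"; "SsW2swS"; "s>NWv<w"; "E^nwNSW"; "NWn^wW<"; "ee>^<nN"]);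
  (([2; 1; 2], [2; 0; 0; 3]),
   ["eE>eesvS"; ">sES>Wvw"; "Sv0E1vsW"; "^NWnw<W<"; "n>N2<<sN"; "EN>W^ees"; "nwnwN^<w"]);
  (([2; 1; 2], [2; 0; 1; 2]),
   ["eS>sv<W<"; "veEESesW"; "vS0wE1s^"; "SWWn>>vw"; ">Nn2Ne<n"; "E>>e^nwN"; "N-^Wen>^"]);
  (([2; 1; 2], [2; 1; 0; 2]),
   ["sv<<E<S<"; "EEEevesS"; "vN0Ew1vs"; "eNWnnwvw"; "Ne>n2N<n"; "N>^nW<en"; ">^NnwNWW"]);
  (([2; 1; 2], [2; 1; 1; 2]),
   ["s>E>wv<<S"; "ES>^nSwWW"; "N^0vE<1sv"; "NEn>Nwv^w"; "esSw2S<s<"; ">^<EEnwwN"; "NeW^eW<<n"]);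
  (([2; 1; 2], [3; 0; 0; 2]),
   ["vESWe<sw"; "sEw>vwS<"; ">Nv0E1vn"; "ENWWNvWn"; "sw>N2<sS"; "evN<es<W"; "^<NnWww^"]);
  (([2; 1; 3], [2; 0; 0; 2]),
   ["svEE<ES"; "sE>vwN<"; "Sv0w1s^"; "v<<nN<W"; ">Nn2-sS"; "een^<wS"; "^NWWWnw"; "E^NeenW"]);
  (([2; 2; 2], [2; 0; 0; 2]),
   ["ES>vesw"; ">eEv<sS"; "^S0E1sv"; "^<EsNWW"; "sS>w>v<"; "enN2s<N"; "^SnWwww"; "^ENeWen"]);
  (([3; 0; 2], [2; 0; 0; 3]),
   [">>>eesSv"; "eEEEveSs"; "^eNs<Wvs"; "^N0w1nwv"; "SnW2<Nn<"; "^n<wwN<W"; "En^EN<Ww"]);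
  (([3; 0; 2], [2; 0; 1; 2]),
   ["SW>Wsv<W"; ">>EsvwSw"; "Eesvw<wS"; "N^0wE1vn"; "sN>2nwS<"; "eN^e<<<n"; "nNWWN^WW"]);
  (([3; 0; 2], [2; 1; 0; 2]),
   ["SeWvsw<<"; "eE>>vnES"; "En^EE<Nw"; "vN0Ew1^n"; "n>Sw2esS"; "En>NWvwW"; ">nENe>^n"]);
  (([3; 0; 2], [3; 0; 0; 2]),
   [">SE>vsES"; "^eeES<Ws"; "eSvsww<<"; "ESv0E1^s"; "nS>>2swS"; "N>^WW<nw"; "^ENnwwNW"]);
  (([3; 0; 3], [2; 0; 0; 2]),
   ["vS<swwW"; ">>Ss>v<"; "SeWWnvw"; "^S0w1n^"; "s>S2NWn"; "eE-sEN^"; "S^<ee<n"; "ENWW>^n"]);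
  (([3; 1; 2], [2; 0; 0; 2]),
   [">sES>vW"; "EEsESvw"; "Ne>swv<"; "^N0w1s^"; "eN>n>w^"; "nNW2N<n"; "n>^EwEN"; "N^eeWn^"]);
  (([4; 0; 2], [2; 0; 0; 2]),
   ["sv<SSWW"; "eS^s<w<"; ">SsW^Ww"; "^eEswNN"; "^S0w1n^"; "nS>2<Nn"; "^EnEw<N"; "E>Ee^nN"])
].

Definition layouts33a : list drawing := [
  (([2; 0; 0; 2], [2; 0; 0; 3]),
   ["vE<SesWv"; "e>E>vENs"; "vN0wv<Nw"; "n^<1Wevn"; "nwSw2Ns<"; "E>Sven<W"; ">NW>Wnw^"]);
  (([2; 0; 0; 2], [2; 0; 1; 2]),
   [">E>Ssv<W"; "EvE<eEsN"; "^N0wvwS<"; ">vn1vnW^"; "sw>NW2sN"; "e>n>NW^w"; "^nEw<wwN"]);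
  (([2; 0; 0; 2], [2; 1; 0; 2]),
   ["EE>e>sSv"; "e>ESsWvW"; "vN0SwvW<"; ">^nE1es^"; ">eEnN2sN"; "^<nNwW<w"; "^N<<<een"]);
  (([2; 0; 0; 2], [2; 1; 1; 2]),
   ["ESWvSWsWw"; "e->v<sEN<"; "vS0Swvw<W"; "n>nv1even"; "nE>>wN2nN"; ">eSEn>wN^"; "enEw>^E<N"]);
  (([2; 0; 0; 2], [3; 0; 0; 2]),
   ["EESW>sWv"; "Ns>>wwvW"; "Ns^0Svww"; ">vEn1Wvn"; "es>EN2nN"; "n>^N<w<<"; "^ee<eENn"]);
  (([2; 0; 0; 3], [2; 0; 0; 2]),
   ["vEE<esS"; "E>>envS"; "vN0Svww"; "esv1Wnv"; ">N>s2Sn"; "n>^NWWW"; "N^<een<"; "NeW>n>^"]);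
  (([2; 0; 1; 2], [2; 0; 0; 2]),
   ["EvEeSs<"; ">S>>Wvs"; "^S0S>w^"; "vEn1evs"; ">NWe^nw"; "e>nN2nS"; "nN>vw<W"; "^eN<WWn"]);
  (([2; 0; 1; 2], [2; 0; 1; 2]),
   ["S>Wvs<ES"; "eE>>veNs"; "S^0wvSww"; "Esv1eWvn"; ">svw<-Nn"; "^en>S2Nn"; "Nn>^^W<W"; "^NWnWwn<"]);
  (([2; 0; 1; 2], [2; 1; 0; 2]),
   ["v<ESeW<s"; "S^<<<swW"; "vS0^wNwv"; "e^<s1sWv"; "ESnWwe^s"; ">>Sen2Ns"; ">ES^<Wn<"; "nwE-^wNw"]);
  (([2; 0; 1; 2], [2; 1; 1; 2]),
   ["ES>ve<ees"; "veEs<ESWW"; "Nv0wESvWW"; ">vEs1^EnN"; "enN>sSv<N"; "Nn>W>w2nN"; "N>^swWwww"; "NE^eNnWn<"]);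
  (([2; 1; 0; 2], [2; 0; 0; 2]),
   ["ee>evSs"; "nvE<w<S"; "vS0SWwv"; "E>vSnWv"; "n^E1vnW"; "Nn>w2Ns"; "N^<<en<"; ">En^ENw"]);
  (([2; 1; 0; 2], [2; 0; 1; 2]),
   ["veESsww<"; "eE>>vEnS"; "Sv0wvNWw"; "n>ES>v-S"; "nEv1WNvn"; ">^nwN2nS"; "EnenwwN^"; "nN>>^W<W"]);
  (([2; 1; 0; 2], [2; 1; 0; 2]),
   [">E>v<SWs"; "S>W>esvw"; "^N0S^WwW"; "seEvSen<"; "EsvE1nw^"; "sNn>w2Nn"; "esvw<w<N"; "ne>enEN^"]);
  (([2; 1; 0; 2], [2; 1; 1; 2]),
   ["v<Ees<sSw"; "sE>vwESWv"; "Sv0>SvWwS"; ">v<E<swvS"; "svE-1vN<n"; "Sen>>>2nS"; "e>Nsw>w^<"; "E^nwNwWWW"]);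
  (([2; 1; 1; 2], [2; 0; 0; 2]),
   ["EeE>svS"; "Nn>s>vw"; "vS0ssSv"; "esvweSn"; "vsE1^s<"; "Ns>wWW^"; "NWn>2sS"; "n>^NWwW"; ">en^w<N"]);
  (([2; 1; 1; 2], [2; 0; 1; 2]),
   ["v<>SsvwW"; "swEwvESs"; "S^0Svvn<"; "-En>wNvs"; "Evn1vsEN"; ">Nv<nw<w"; "N>ven2Nn"; "se>N>Wn^"; "enE^EwwN"]);
  (([2; 1; 1; 2], [2; 1; 0; 2]),
   ["v<<SeswW"; "swEwvESs"; "vS0EvNn<"; "-ES>>vWs"; "EnE^1svN"; ">Nv<sw<w"; "Nnnww2nN"; "se>N>Wn^"; "enE^EwwN"]);
  (([2; 1; 1; 2], [2; 1; 1; 2]),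
   ["SsWwswWvW"; "sE>vSWNWN"; "Sv0>wv-Nw"; "sNvW<-eNn"; "svE-1vN<n"; "e>>vNs<W<"; "EEnN>>2Nn"; ">enNwwww^"; "NEe>nNW^W"]);
  (([3; 0; 0; 2], [2; 0; 0; 2]),
   [">SveWWs"; "svESWwW"; "Ev<nNnw"; "Nv0>vN<"; "evn1en^"; "NWWs2nN"; "n>>>wN^"; "Ne^eW<n"])
].

Definition layouts33b : list drawing := [
  (([2; 0; 0; 2], [2; 0; 0; 3]),
   ["Ev<SesSW"; ">EEsv<Sw"; "^N0w>wSv"; "sv<E1n>v"; "swS2enS<"; "e>nwNWwv"; "NnWW>^W<"]);
  (([2; 0; 0; 2], [2; 0; 1; 2]),
   ["Ee>S>svw"; "s>EvS<-<"; "N^0w^wES"; "s^<Ew1s^"; "NWn2E<Nn"; ">nSw^^<W"; "eNWW^een"]);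
  (([2; 0; 0; 2], [2; 1; 0; 2]),
   ["ESWvWsW<"; ">>>EveSs"; "N^0vN<ww"; "e^nww1n^"; "nEEN2enS"; "^e<nwNWW"; "^NW<W<<n"]);
  (([2; 0; 0; 2], [2; 1; 1; 2]),
   ["es>EEEwvS"; "S>WE-sSWv"; "vS0v<w<Nw"; ">eEven1sv"; "Sn>w2Neen"; "SE^Ne<n<W"; "En^<EN<W<"]);
  (([2; 0; 0; 2], [3; 0; 0; 2]),
   ["vEs<S<WW"; "s>EEvwNw"; "ENv0w^wN"; ">^s<E1vs"; "sw>S2sN<"; "eNsEw>N^"; "^NenWw<w"]);
  (([2; 0; 0; 3], [2; 0; 0; 2]),
   ["EvESe-s"; "sS>W>wv"; "Nv0N^<w"; "vsEw1^n"; "N>n2sES"; ">eN^<nW"; "eE>e^Nn"; "^nNWwW<"]);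
  (([2; 0; 1; 2], [2; 0; 0; 2]),
   ["Es>Ev<S"; ">EEv<sS"; "^N0wwSv"; "s>>v1sv"; "e^nNwWw"; "nNW2Ns<"; "Ns^WNwW"; "Nenw>n^"]);
  (([2; 0; 1; 2], [2; 0; 1; 2]),
   ["S>>vs<S<"; "S^EeveSs"; "S^0EvSwW"; "SE>nv1vs"; "EeEvesEN"; "eNn2<<nN"; "nwNw^w<N"; ">nnEE^Nw"]);
  (([2; 0; 1; 2], [2; 1; 0; 2]),
   ["S>>vs<ES"; "SsEwvSww"; "S^0>vwSW"; "SevsE1vn"; "EEEeesvN"; "N^nW2NWn"; "eNn^ww<N"; ">n>^E<N<"]);
  (([2; 0; 1; 2], [2; 1; 1; 2]),
   ["vsE<E<wSw"; "sE>>wS>Wv"; "Sv0->^SW<"; "evn---1vn"; "EsE>>vN<n"; "Nenw2<esS"; "N>n^wwWwW"; ">n>EEE>^N"]);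
  (([2; 1; 0; 2], [2; 0; 0; 2]),
   ["Se>eswv"; "s>ESwvw"; "S^0ES>v"; "ESvn<WW"; "eEnv1nv"; "Nn>2eNn"; ">n^w<N<"; "^NWWW^n"]);
  (([2; 1; 0; 2], [2; 0; 1; 2]),
   [">s>vE<<S"; "^eEEsSsw"; "Sv0NwwWv"; "eEEveSs-"; "Ev<es1^n"; "N>n2swwS"; "nnNw>>^W"; "-n^EwnN<"]);
  (([2; 1; 0; 2], [2; 1; 0; 2]),
   ["S>WvWsW<"; "SW>evswW"; "S^0>v<Nw"; "SNWWeevn"; "Eevn-1vn"; "NvnN2<nN"; "eN>>e^Nn"; ">>n^Ew<N"]);
  (([2; 1; 0; 2], [2; 1; 1; 2]),
   ["v<EEs<>vS"; "sw>vwSwWw"; "Sv0-EwSvn"; ">vEe<n^ES"; "sEN>-^1vn"; "E>nS2Seen"; "e>NnWn>v<"; "^n<EwEN<W"]);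
  (([2; 1; 1; 2], [2; 0; 0; 2]),
   ["ESWWvsS"; "e->swvS"; "vS0>>Sv"; "nwvNwWw"; ">n>^1sv"; "nEnwN>v"; "N>n2<Nn"; "^nEEwNW"; "Nnww^w<"]);
  (([2; 1; 1; 2], [2; 0; 1; 2]),
   ["svESW<W<"; "e>>ss>vS"; "S^0wvSsw"; "neEv<eNn"; "n^wEw1vn"; ">Ev<Nees"; "enN2nN<w"; "Sn>Ww>w^"; "E^eenNwW"]);
  (([2; 1; 1; 2], [2; 1; 0; 2]),
   ["v<<Sv<s<"; "esEvSESw"; "S^0EvNsW"; "eeSveesn"; "Ev<s-1vn"; ">S^<We<n"; "Nnnw2N^n"; "N>WnW>w^"; "nE^NwNW^"]);
  (([2; 1; 1; 2], [2; 1; 1; 2]),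
   ["SsWwsv>vW"; "Es>vEESWs"; "Nv0>wvS<w"; "sE>^nwwNn"; "s>E>>v1^n"; "eeNWnv<W<"; "En>N2nS-W"; ">n^<EnwwN"; "NEe^e<ENn"]);
  (([3; 0; 0; 2], [2; 0; 0; 2]),
   ["eS>e>vs"; ">esSwvw"; "S>W>nvW"; "^S0E^wN"; "EnE^1vn"; "Nn>2sEN"; "^nNw<>v"; "nE^EwN<"])
].

Local Close Scope string_scope.

(** A pattern gives, for each colour, the index of its row and of its column among the lines with
    sinks. With two rows and three columns, the lone sink has its column outside the pair in
    [pat23a] and between the pair in [pat23b]. With three rows and columns the sinks form a
    permutation: monotone ones reduce to [pat33a], the other four to [pat33b]. *)
Definition pat13 (i : nat) : nat * nat := (0%nat, i).
Definition pat22 (i : nat) : nat * nat :=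
  match i with 0 => (0, 0) | 1 => (0, 1) | _ => (1, 0) end%nat.
Definition pat23a (i : nat) : nat * nat :=
  match i with 0 => (0, 0) | 1 => (0, 1) | _ => (1, 2) end%nat.
Definition pat23b (i : nat) : nat * nat :=
  match i with 0 => (0, 0) | 1 => (0, 2) | _ => (1, 1) end%nat.
Definition pat33a (i : nat) : nat * nat := (i, i).
Definition pat33b (i : nat) : nat * nat :=
  match i with 0 => (0, 0) | 1 => (1, 2) | _ => (2, 1) end%nat.

Lemma layouts13_ok : forallb (drawing_ok pat13) layouts13 = true.
Proof. vm_compute; reflexivity. Qed.
Lemma layouts22_ok : forallb (drawing_ok pat22) layouts22 = true.
Proof. vm_compute; reflexivity. Qed.
Lemma layouts23a_ok : forallb (drawing_ok pat23a) layouts23a = true.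
Proof. vm_compute; reflexivity. Qed.
Lemma layouts23b_ok : forallb (drawing_ok pat23b) layouts23b = true.
Proof. vm_compute; reflexivity. Qed.
Lemma layouts33a_ok : forallb (drawing_ok pat33a) layouts33a = true.
Proof. vm_compute; reflexivity. Qed.
Lemma layouts33b_ok : forallb (drawing_ok pat33b) layouts33b = true.
Proof. vm_compute; reflexivity. Qed.

(* The size conditions in terms of gaps. The excluded cases are, in this order,
   configurations A, A, C, D and D for three sinks in a row, and B for an L. *)
Definition ok13 (g h : list Z) : bool :=
  match g, h with
  | [a; b], [c; d; e; f] =>
      ((6 <=? a + b) || (5 <=? a + b) && (6 <=? c + d + e + f) || (8 <=? c + d + e + f)) &&
      negb ((a =? 2) && (b =? 2) &&
        ((c =? 2) && (d =? 0) || (f =? 2) && (e =? 0) || (d =? 0) && (e =? 0) ||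
         (c =? 2) && (d =? 1) && (e =? 0) || (f =? 2) && (e =? 1) && (d =? 0)))
  | _, _ => false
  end.

Definition ok22 (g h : list Z) : bool :=
  match g, h with
  | [a; x; b], [c; y; d] =>
      ((5 <=? a + x + b) && (5 <=? c + y + d) || (7 <=? a + x + b) || (7 <=? c + y + d)) &&
      negb ((a =? 2) && (c =? 2) && (x =? 0) && (y =? 0))
  | _, _ => false
  end.

Definition ok23 (g h : list Z) : bool :=
  match g, h with
  | [a; x; b], [c; y; z; d] =>
      (6 <=? a + x + b) || (6 <=? c + y + z + d) || (5 <=? a + x + b) && (5 <=? c + y + z + d)
  | _, _ => false
  end.

(** With [p = q = 3] both sides are at least 7 long, so [7] by [8] amounts to [m + n >= 15], that
    is, to gaps of total 9. *)
Definition ok33 (g h : list Z) : bool :=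
  match g, h with
  | [a; x; y; b], [c; z; t; d] => 9 <=? a + x + y + b + c + z + t + d
  | _, _ => false
  end.

(** The caps are chosen such that one gap at its cap, with all others at their minimum (2 outside, 0
    inside), already reaches the largest threshold for its sum. Here these are [4+2 = 6] for rows,
    [6+2] and [4+2+2 = 8] for columns; below, [5+2] and [3+2+2 = 7] for [ok22], [4+2] and
    [2+2+2 = 6] for [ok23], and over both axes [3+2+2+2] and [1+2+2+2+2 = 9] for [ok33]. Truncation
    therefore never destroys a size condition. *)
Lemma covered13 : all_covered layouts13 ok13 [(2, 4); (2, 4)] [(2, 6); (0, 4); (0, 4); (2, 6)] = true.
Proof. vm_compute; reflexivity. Qed.
Lemma covered22 :
  all_covered layouts22 ok22 [(2, 5); (0, 3); (2, 5)] [(2, 5); (0, 3); (2, 5)] = true.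
Proof. vm_compute; reflexivity. Qed.
Lemma covered23a :
  all_covered layouts23a ok23 [(2, 4); (0, 2); (2, 4)] [(2, 4); (0, 2); (0, 2); (2, 4)] = true.
Proof. vm_compute; reflexivity. Qed.
Lemma covered23b :
  all_covered layouts23b ok23 [(2, 4); (0, 2); (2, 4)] [(2, 4); (0, 2); (0, 2); (2, 4)] = true.
Proof. vm_compute; reflexivity. Qed.
Lemma covered33a :
  all_covered layouts33a ok33 [(2, 3); (0, 1); (0, 1); (2, 3)] [(2, 3); (0, 1); (0, 1); (2, 3)] = true.
Proof. vm_compute; reflexivity. Qed.
Lemma covered33b :
  all_covered layouts33b ok33 [(2, 3); (0, 1); (0, 1); (2, 3)] [(2, 3); (0, 1); (0, 1); (2, 3)] = true.
Proof. vm_compute; reflexivity. Qed.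

(** * Normalising the position of the sinks *)

(** Packaged as one predicate of the board so that each normalisation is the application of a
    symmetry. Condition (1) is weakened to distances, which symmetries preserve without any counting
    of blanks. *)
Definition solvable (m n : Z) (sink : nat -> cell) : Prop :=
  valid_board m n sink ->
  (forall i d, (i < 3)%nat -> 2 <= dist_to_side m n (sink i) d) ->
  ~ configA m n sink -> ~ configB m n sink -> ~ configC m n sink -> ~ configD m n sink ->
  cond3 m n sink -> has_perfect_layout m n sink.

Lemma solvable_iso m n s m' n' s' f e c :
  board_iso m n s m' n' s' f e c -> solvable m' n' s' -> solvable m n s.
Proof.
  intros H Hsol HB HD HA HBb HC HDd H3. pose proof (iso_sym _ _ _ _ _ _ _ _ _ H) as HS.
  destruct Hsol as [L HL].
  - eapply iso_valid_board; eauto.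
  - intros i d Hi. rewrite <- (iso_dist _ _ _ _ _ _ _ _ _ HS), (iso_sink _ _ _ _ _ _ _ _ _ HS) by auto.
    apply HD. apply H; auto.
  - intros Hx; apply HA; eapply iso_configA; eauto.
  - intros Hx; apply HBb; eapply iso_configB; eauto.
  - intros Hx; apply HC; eapply iso_configC; eauto.
  - intros Hx; apply HDd; eapply iso_configD; eauto.
  - eapply iso_cond3; eauto.
  - exists (pullback f e c L). eapply iso_perfect; eauto.
Qed.

(** Only the sinks of colours 0, 1 and 2 matter; this stands in for equality of functions. *)
Lemma iso_ext m n s m' n' s' s'' f e c :
  board_iso m n s m' n' s' f e c -> (forall i, (i < 3)%nat -> s' i = s'' i) ->
  board_iso m n s m' n' s'' f e c.
Proof.
  intros [H1 H2 H3 H4 H5 H6 H7 H8 H9] Hs. constructor; auto.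
  - intros i Hi. rewrite H8, Hs; auto.
  - unfold rows_with_sink, cols_with_sink in *.
    rewrite !Hs in H9 by lia. exact H9.
Qed.

Definition tri (a b c : cell) (i : nat) : cell :=
  match i with 0%nat => a | 1%nat => b | _ => c end.

Ltac tri_ext := intros [|[|[|i]]] Hi; try lia; reflexivity.

Lemma iso_refl m n s : board_iso m n s m n s (fun p => p) (fun d => d) (fun i => i).
Proof. constructor; auto. Qed.

Lemma solvable_tri m n s : solvable m n (tri (s 0%nat) (s 1%nat) (s 2%nat)) -> solvable m n s.
Proof. eapply solvable_iso, iso_ext; [apply iso_refl|tri_ext]. Qed.

Lemma solvable_swap01 m n a b c : solvable m n (tri b a c) -> solvable m n (tri a b c).
Proof.
  eapply solvable_iso, iso_ext; [apply (iso_recolor m n (tri a b c) 0 1); lia|tri_ext].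
Qed.

Lemma solvable_swap12 m n a b c : solvable m n (tri a c b) -> solvable m n (tri a b c).
Proof.
  eapply solvable_iso, iso_ext; [apply (iso_recolor m n (tri a b c) 1 2); lia|tri_ext].
Qed.

Lemma solvable_transpose m n r0 c0 r1 c1 r2 c2 :
  solvable n m (tri (c0, r0) (c1, r1) (c2, r2)) -> solvable m n (tri (r0, c0) (r1, c1) (r2, c2)).
Proof. eapply solvable_iso, iso_ext; [apply iso_transpose|tri_ext]. Qed.

Lemma solvable_vflip m n r0 c0 r1 c1 r2 c2 :
  solvable m n (tri (m - 1 - r0, c0) (m - 1 - r1, c1) (m - 1 - r2, c2)) ->
  solvable m n (tri (r0, c0) (r1, c1) (r2, c2)).
Proof. eapply solvable_iso, iso_ext; [apply iso_vflip|tri_ext]. Qed.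

Lemma solvable_hflip m n r0 c0 r1 c1 r2 c2 :
  solvable m n (tri (r0, n - 1 - c0) (r1, n - 1 - c1) (r2, n - 1 - c2)) ->
  solvable m n (tri (r0, c0) (r1, c1) (r2, c2)).
Proof. intros H. apply solvable_transpose, solvable_vflip, solvable_transpose, H. Qed.

Lemma solvable_covered m n s pat db ok l1 l2 g h :
  forallb (drawing_ok pat) db = true -> all_covered db ok l1 l2 = true ->
  valid_board m n s -> m = axis_length g -> n = axis_length h ->
  (forall i, (i < 3)%nat -> s i = gap_sink pat g h i) ->
  (forall i, (i < 3)%nat -> (fst (pat i) < length g)%nat /\ (snd (pat i) < length h)%nat) ->
  Forall2 in_range l1 g -> Forall2 in_range l2 h -> ok (clamp l1 g) (clamp l2 h) = true ->
  has_perfect_layout m n s.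
Proof.
  intros Hdb Hcov HB -> -> Hs Hpat Hg Hh Hok.
  pose proof (iso_ext _ _ _ _ _ _ _ _ _ _ (iso_refl (axis_length g) (axis_length h) s) Hs) as HI.
  destruct (covered_perfect pat db ok l1 l2 g h) as [L HL]; auto.
  - eapply iso_valid_board; eauto.
  - eexists. eapply iso_perfect; eauto.
Qed.

Ltac outer_gaps HD :=
  pose proof (HD 0%nat DN ltac:(lia)); pose proof (HD 0%nat DS ltac:(lia));
  pose proof (HD 0%nat DE ltac:(lia)); pose proof (HD 0%nat DW ltac:(lia));
  pose proof (HD 1%nat DN ltac:(lia)); pose proof (HD 1%nat DS ltac:(lia));
  pose proof (HD 1%nat DE ltac:(lia)); pose proof (HD 1%nat DW ltac:(lia));
  pose proof (HD 2%nat DN ltac:(lia)); pose proof (HD 2%nat DS ltac:(lia));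
  pose proof (HD 2%nat DE ltac:(lia)); pose proof (HD 2%nat DW ltac:(lia));
  clear HD; cbn [dist_to_side tri fst snd] in *.

Ltac sink_lines s p q Er Ec :=
  let Hr := fresh in let Hc := fresh in
  pose proof (rows_with_sink_cases s) as Hr;
  pose proof (rows_with_sink_cases (fun i => swap (s i))) as Hc;
  change (rows_with_sink (fun i => swap (s i))) with (cols_with_sink s) in Hc;
  cbv zeta in Hr, Hc; cbn [tri fst snd swap] in Hr, Hc;
  assert (Er : rows_with_sink s = p) by (clear Hc; lia);
  assert (Ec : cols_with_sink s = q) by (clear Hr; lia);
  clear Hr Hc.

Ltac tri_sink :=
  intros [|[|[|?]]] ?; try lia; unfold gap_sink; cbn; f_equal; lia.
Ltac tri_two_away := unfold two_away, is_sinkb, cell_eqb, shift; cbn; lia.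

(** The excluded configurations test gaps for values below their caps, so the tests see through
    truncation. *)
Lemma min_eqb x c k : k < c -> (Z.min x c =? k) = (x =? k).
Proof. lia. Qed.

Lemma solvable13 m n r c0 c1 c2 : c0 < c1 -> c1 < c2 ->
  solvable m n (tri (r, c0) (r, c1) (r, c2)).
Proof.
  intros H01 H12 HB HD HA HBb HC HDd H3. outer_gaps HD.
  sink_lines (tri (r, c0) (r, c1) (r, c2)) 1%nat 3%nat Er Ec.
  (* The gaps sum to [m - 1] and [n - 3]. As [m >= 5] and [n >= 7] hold already, the three
     alternatives are [7] by [7], [6] by [9] and [5] by [11]; the shapes with the sides exchanged
     fall under the first. *)
  assert (Hsize : m - 1 >= 6 \/ m - 1 >= 5 /\ n - 3 >= 6 \/ n - 3 >= 8).
  { unfold cond3 in H3; cbv zeta in H3. rewrite Er, Ec in H3. destruct H3 as [_ [_ [_ H3]]].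
    unfold size_at_least in H3. specialize (H3 ltac:(left; auto)). lia. }
  clear H3 Er Ec.
  assert (NA1 : ~ (r = 2 /\ m - 1 - r = 2 /\ c0 = 2 /\ c1 - c0 - 1 = 0)).
  { intros E. apply HA. exists 0%nat; split; [lia|]. exists DN, DS, DW.
    do 3 (split; [discriminate|]). do 3 (split; [tri_two_away|]).
    exists 1%nat. unfold adjacent; cbn. lia. }
  assert (NA2 : ~ (r = 2 /\ m - 1 - r = 2 /\ n - 1 - c2 = 2 /\ c2 - c1 - 1 = 0)).
  { intros E. apply HA. exists 2%nat; split; [lia|]. exists DN, DS, DE.
    do 3 (split; [discriminate|]). do 3 (split; [tri_two_away|]).
    exists 1%nat. unfold adjacent; cbn. lia. }
  assert (NC : ~ (r = 2 /\ m - 1 - r = 2 /\ c1 - c0 - 1 = 0 /\ c2 - c1 - 1 = 0)).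
  { intros E. apply HC. exists 1%nat; split; [lia|]. exists DN.
    do 2 (split; [tri_two_away|]).
    intros [|[|[|j]]] Hj Nj; unfold adjacent; cbn; lia. }
  assert (ND1 : ~ (r = 2 /\ m - 1 - r = 2 /\ c0 = 2 /\ c1 - c0 - 1 = 1 /\ c2 - c1 - 1 = 0)).
  { intros E. apply HDd. exists 0%nat, 1%nat, 2%nat. do 6 (split; [lia|]).
    exists DN, DS, DW, DE. do 6 (split; [discriminate|]). do 3 (split; [tri_two_away|]).
    unfold in_grid, is_sinkb, cell_eqb, adjacent, shift; cbn.
    repeat split; try lia. f_equal; lia. }
  assert (ND2 : ~ (r = 2 /\ m - 1 - r = 2 /\ n - 1 - c2 = 2 /\ c2 - c1 - 1 = 1 /\ c1 - c0 - 1 = 0)).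
  { intros E. apply HDd. exists 2%nat, 1%nat, 0%nat. do 6 (split; [lia|]).
    exists DN, DS, DE, DW. do 6 (split; [discriminate|]). do 3 (split; [tri_two_away|]).
    unfold in_grid, is_sinkb, cell_eqb, adjacent, shift; cbn.
    repeat split; try lia. f_equal; lia. }
  clear HA HBb HC HDd.
  apply (solvable_covered m n _ pat13 layouts13 ok13 _ _ [r; m - 1 - r]
           [c0; c1 - c0 - 1; c2 - c1 - 1; n - 1 - c2] layouts13_ok covered13); auto.
  - unfold axis_length; cbn; lia.
  - unfold axis_length; cbn; lia.
  - tri_sink.
  - intros i Hi; cbn; lia.
  - repeat constructor; cbn; lia.
  - repeat constructor; cbn; lia.
  - clear HB. cbn [clamp ok13]. apply andb_true_iff; split.
    + clear NA1 NA2 NC ND1 ND2. destruct Hsize as [Hs|[Hs|Hs]].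
      * assert (6 <= Z.min r 4 + Z.min (m - 1 - r) 4) by lia. lia.
      * assert (5 <= Z.min r 4 + Z.min (m - 1 - r) 4) by lia.
        assert (6 <= Z.min c0 6 + Z.min (c1 - c0 - 1) 4 + Z.min (c2 - c1 - 1) 4 + Z.min (n - 1 - c2) 6) by lia.
        lia.
      * assert (8 <= Z.min c0 6 + Z.min (c1 - c0 - 1) 4 + Z.min (c2 - c1 - 1) 4 + Z.min (n - 1 - c2) 6) by lia.
        lia.
    + rewrite !min_eqb by lia. lia.
Qed.

Lemma solvable22 m n r0 r1 c0 c1 : r0 < r1 -> c0 < c1 ->
  solvable m n (tri (r0, c0) (r0, c1) (r1, c0)).
Proof.
  intros Hr Hc HB HD HA HBb HC HDd H3. outer_gaps HD.
  sink_lines (tri (r0, c0) (r0, c1) (r1, c0)) 2%nat 2%nat Er Ec.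
  assert (Hsize : m - 2 >= 5 /\ n - 2 >= 5 \/ m - 2 >= 7 \/ n - 2 >= 7).
  { unfold cond3 in H3; cbv zeta in H3. rewrite Er, Ec in H3. destruct H3 as [_ [_ [H3 _]]].
    unfold size_at_least in H3. specialize (H3 ltac:(auto)). lia. }
  clear H3 Er Ec.
  assert (NB : ~ (r0 = 2 /\ c0 = 2 /\ r1 - r0 - 1 = 0 /\ c1 - c0 - 1 = 0)).
  { intros E. apply HBb. exists 0%nat; split; [lia|]. exists DN, DW. split; [discriminate|].
    do 2 (split; [tri_two_away|]).
    intros [|[|[|j]]] Hj Nj; unfold adjacent; cbn; lia. }
  clear HA HBb HC HDd.
  apply (solvable_covered m n _ pat22 layouts22 ok22 _ _ [r0; r1 - r0 - 1; m - 1 - r1]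
           [c0; c1 - c0 - 1; n - 1 - c1] layouts22_ok covered22); auto.
  - unfold axis_length; cbn; lia.
  - unfold axis_length; cbn; lia.
  - tri_sink.
  - intros [|[|[|i]]] Hi; cbn; lia.
  - repeat constructor; cbn; lia.
  - repeat constructor; cbn; lia.
  - clear HB. cbn [clamp ok22]. apply andb_true_iff; split.
    + clear NB. lia.
    + rewrite !min_eqb by lia. lia.
Qed.

Lemma solvable23a m n r0 r1 c0 c1 c2 : r0 < r1 -> c0 < c1 -> c1 < c2 ->
  solvable m n (tri (r0, c0) (r0, c1) (r1, c2)).
Proof.
  intros Hr Hc Hc' HB HD _ _ _ _ H3. outer_gaps HD.
  sink_lines (tri (r0, c0) (r0, c1) (r1, c2)) 2%nat 3%nat Er Ec.
  assert (Hsize : m - 2 >= 6 \/ n - 3 >= 6 \/ m - 2 >= 5 /\ n - 3 >= 5).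
  { unfold cond3 in H3; cbv zeta in H3. rewrite Er, Ec in H3. destruct H3 as [_ [H3 _]].
    unfold size_at_least in H3. specialize (H3 ltac:(left; auto)). lia. }
  clear H3 Er Ec.
  apply (solvable_covered m n _ pat23a layouts23a ok23 _ _ [r0; r1 - r0 - 1; m - 1 - r1]
           [c0; c1 - c0 - 1; c2 - c1 - 1; n - 1 - c2] layouts23a_ok covered23a); auto.
  - unfold axis_length; cbn; lia.
  - unfold axis_length; cbn; lia.
  - tri_sink.
  - intros [|[|[|i]]] Hi; cbn; lia.
  - repeat constructor; cbn; lia.
  - repeat constructor; cbn; lia.
  - clear HB. cbn [clamp ok23]. lia.
Qed.

Lemma solvable23b m n r0 r1 c0 c1 c2 : r0 < r1 -> c0 < c1 -> c1 < c2 ->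
  solvable m n (tri (r0, c0) (r0, c2) (r1, c1)).
Proof.
  intros Hr Hc Hc' HB HD _ _ _ _ H3. outer_gaps HD.
  sink_lines (tri (r0, c0) (r0, c2) (r1, c1)) 2%nat 3%nat Er Ec.
  assert (Hsize : m - 2 >= 6 \/ n - 3 >= 6 \/ m - 2 >= 5 /\ n - 3 >= 5).
  { unfold cond3 in H3; cbv zeta in H3. rewrite Er, Ec in H3. destruct H3 as [_ [H3 _]].
    unfold size_at_least in H3. specialize (H3 ltac:(left; auto)). lia. }
  clear H3 Er Ec.
  apply (solvable_covered m n _ pat23b layouts23b ok23 _ _ [r0; r1 - r0 - 1; m - 1 - r1]
           [c0; c1 - c0 - 1; c2 - c1 - 1; n - 1 - c2] layouts23b_ok covered23b); auto.
  - unfold axis_length; cbn; lia.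
  - unfold axis_length; cbn; lia.
  - tri_sink.
  - intros [|[|[|i]]] Hi; cbn; lia.
  - repeat constructor; cbn; lia.
  - repeat constructor; cbn; lia.
  - clear HB. cbn [clamp ok23]. lia.
Qed.

Lemma solvable33a m n r0 r1 r2 c0 c1 c2 : r0 < r1 -> r1 < r2 -> c0 < c1 -> c1 < c2 ->
  solvable m n (tri (r0, c0) (r1, c1) (r2, c2)).
Proof.
  intros Hr Hr' Hc Hc' HB HD _ _ _ _ H3. outer_gaps HD.
  sink_lines (tri (r0, c0) (r1, c1) (r2, c2)) 3%nat 3%nat Er Ec.
  assert (Hsize : m - 3 + (n - 3) >= 9).
  { unfold cond3 in H3; cbv zeta in H3. rewrite Er, Ec in H3. destruct H3 as [H3 _].
    unfold size_at_least in H3. specialize (H3 ltac:(auto)). lia. }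
  clear H3 Er Ec.
  apply (solvable_covered m n _ pat33a layouts33a ok33 _ _
           [r0; r1 - r0 - 1; r2 - r1 - 1; m - 1 - r2]
           [c0; c1 - c0 - 1; c2 - c1 - 1; n - 1 - c2] layouts33a_ok covered33a); auto.
  - unfold axis_length; cbn; lia.
  - unfold axis_length; cbn; lia.
  - tri_sink.
  - intros [|[|[|i]]] Hi; cbn; lia.
  - repeat constructor; cbn; lia.
  - repeat constructor; cbn; lia.
  - clear HB. cbn [clamp ok33]. lia.
Qed.

Lemma solvable33b m n r0 r1 r2 c0 c1 c2 : r0 < r1 -> r1 < r2 -> c0 < c1 -> c1 < c2 ->
  solvable m n (tri (r0, c0) (r1, c2) (r2, c1)).
Proof.
  intros Hr Hr' Hc Hc' HB HD _ _ _ _ H3. outer_gaps HD.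
  sink_lines (tri (r0, c0) (r1, c2) (r2, c1)) 3%nat 3%nat Er Ec.
  assert (Hsize : m - 3 + (n - 3) >= 9).
  { unfold cond3 in H3; cbv zeta in H3. rewrite Er, Ec in H3. destruct H3 as [H3 _].
    unfold size_at_least in H3. specialize (H3 ltac:(auto)). lia. }
  clear H3 Er Ec.
  apply (solvable_covered m n _ pat33b layouts33b ok33 _ _
           [r0; r1 - r0 - 1; r2 - r1 - 1; m - 1 - r2]
           [c0; c1 - c0 - 1; c2 - c1 - 1; n - 1 - c2] layouts33b_ok covered33b); auto.
  - unfold axis_length; cbn; lia.
  - unfold axis_length; cbn; lia.
  - tri_sink.
  - intros [|[|[|i]]] Hi; cbn; lia.
  - repeat constructor; cbn; lia.
  - repeat constructor; cbn; lia.
  - clear HB. cbn [clamp ok33]. lia.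
Qed.

(** * Case distinction on the relative position *)

Lemma solvable_one_row m n r c0 c1 c2 : c0 <> c1 -> c0 <> c2 -> c1 <> c2 ->
  solvable m n (tri (r, c0) (r, c1) (r, c2)).
Proof.
  intros H01 H02 H12.
  destruct (Z.lt_total c0 c1) as [|[|]], (Z.lt_total c0 c2) as [|[|]],
    (Z.lt_total c1 c2) as [|[|]]; try lia.
  - apply solvable13; lia.
  - apply solvable_swap12, solvable13; lia.
  - apply solvable_swap12, solvable_swap01, solvable13; lia.
  - apply solvable_swap01, solvable13; lia.
  - apply solvable_swap01, solvable_swap12, solvable13; lia.
  - apply solvable_swap01, solvable_swap12, solvable_swap01, solvable13; lia.
Qed.

Lemma solvable_two_rows m n r0 r1 c0 c1 c2 : r0 <> r1 -> c0 <> c1 ->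
  solvable m n (tri (r0, c0) (r0, c1) (r1, c2)).
Proof.
  assert (Hcols : forall r0 r1 c0 c1 c2, r0 < r1 -> c0 < c1 ->
            solvable m n (tri (r0, c0) (r0, c1) (r1, c2))).
  { clear. intros r0 r1 c0 c1 c2 Hr Hc.
    (* Five places for [c2]: on [c0] or [c1] the sinks form an L, between them they form [pat23b],
       and on either outer side [pat23a], up to a mirror image. *)
    destruct (Z.lt_total c0 c2) as [|[<-|]].
    - destruct (Z.lt_total c1 c2) as [|[<-|]].
      + apply solvable23a; lia.
      + apply solvable_hflip, solvable_swap01, solvable22; lia.
      + apply solvable23b; lia.
    - apply solvable22; lia.
    - apply solvable_hflip, solvable_swap01, solvable23a; lia. }
  assert (Hrows : forall r0 r1 c0 c1 c2, r0 < r1 -> c0 <> c1 ->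
            solvable m n (tri (r0, c0) (r0, c1) (r1, c2))).
  { clear - Hcols. intros r0 r1 c0 c1 c2 Hr Hc. destruct (Z.lt_total c0 c1) as [|[|]]; [auto|lia|].
    apply solvable_swap01; auto. }
  intros Hr Hc. destruct (Z.lt_total r0 r1) as [|[|]]; [auto|lia|].
  apply solvable_vflip. apply Hrows; lia.
Qed.

Lemma solvable_three_lines m n r0 r1 r2 c0 c1 c2 :
  r0 < r1 -> r1 < r2 -> c0 <> c1 -> c0 <> c2 -> c1 <> c2 ->
  solvable m n (tri (r0, c0) (r1, c1) (r2, c2)).
Proof.
  intros Hr Hr' H01 H02 H12.
  destruct (Z.lt_total c0 c1) as [|[|]], (Z.lt_total c0 c2) as [|[|]],
    (Z.lt_total c1 c2) as [|[|]]; try lia.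
  - apply solvable33a; lia.
  - apply solvable33b; lia.
  (* Reversing the rows reverses the order of the colours; the three swaps compose to the exchange
     of colours 0 and 2, which restores increasing rows. *)
  - apply solvable_vflip, solvable_swap01, solvable_swap12, solvable_swap01, solvable33b; lia.
  - apply solvable_hflip, solvable_vflip, solvable_swap01, solvable_swap12, solvable_swap01,
      solvable33b; lia.
  - apply solvable_hflip, solvable33b; lia.
  - apply solvable_hflip, solvable33a; lia.
Qed.

(** Sinks in a common column come to lie in a common row after transposition; otherwise all rows and
    columns are distinct. *)
Lemma solvable_no_common_row m n r0 r1 r2 c0 c1 c2 :
  r0 < r1 -> r1 < r2 -> solvable m n (tri (r0, c0) (r1, c1) (r2, c2)).
Proof.
  intros Hr Hr'.
  destruct (Z.eq_dec c0 c1) as [<-|N01]; [|destruct (Z.eq_dec c0 c2) as [<-|N02];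
    [|destruct (Z.eq_dec c1 c2) as [<-|N12]]].
  - apply solvable_transpose. destruct (Z.eq_dec c0 c2) as [<-|N].
    + apply solvable_one_row; lia.
    + apply solvable_two_rows; lia.
  - apply solvable_transpose, solvable_swap12, solvable_two_rows; lia.
  - apply solvable_transpose, solvable_swap01, solvable_swap12, solvable_two_rows; lia.
  - apply solvable_three_lines; lia.
Qed.

Lemma solvable_all m n s : solvable m n s.
Proof.
  apply solvable_tri.
  destruct (s 0%nat) as [r0 c0], (s 1%nat) as [r1 c1], (s 2%nat) as [r2 c2].
  intros HB. assert (Hne : (r0, c0) <> (r1, c1) /\ (r0, c0) <> (r2, c2) /\ (r1, c1) <> (r2, c2)).
  { destruct HB as [_ Hinj]. repeat split; intros E.
    - specialize (Hinj 0%nat 1%nat); cbn in Hinj; lia || (apply Hinj in E; lia).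
    - specialize (Hinj 0%nat 2%nat); cbn in Hinj; lia || (apply Hinj in E; lia).
    - specialize (Hinj 1%nat 2%nat); cbn in Hinj; lia || (apply Hinj in E; lia). }
  revert HB. destruct Hne as [N01 [N02 N12]].
  change (solvable m n (tri (r0, c0) (r1, c1) (r2, c2))).
  destruct (Z.lt_total r0 r1) as [H01|[<-|H01]].
  - destruct (Z.lt_total r1 r2) as [H12|[<-|H12]].
    + apply solvable_no_common_row; lia.
    + apply solvable_swap01, solvable_swap12, solvable_two_rows; congruence || lia.
    + destruct (Z.lt_total r0 r2) as [H02|[<-|H02]].
      * apply solvable_swap12, solvable_no_common_row; lia.
      * apply solvable_swap12, solvable_two_rows; congruence || lia.
      * apply solvable_swap12, solvable_swap01, solvable_no_common_row; lia.
  - destruct (Z.eq_dec r0 r2) as [<-|N].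
    + apply solvable_one_row; congruence.
    + apply solvable_two_rows; congruence.
  - destruct (Z.lt_total r0 r2) as [H02|[<-|H02]].
    + apply solvable_swap01, solvable_no_common_row; lia.
    + apply solvable_swap12, solvable_two_rows; congruence || lia.
    + destruct (Z.lt_total r1 r2) as [H12|[<-|H12]].
      * apply solvable_swap01, solvable_swap12, solvable_no_common_row; lia.
      * apply solvable_swap01, solvable_swap12, solvable_two_rows; congruence || lia.
      * apply solvable_swap01, solvable_swap12, solvable_swap01, solvable_no_common_row; lia.
Qed.

Lemma cond1_dist m n sink i d :
  cond1 m n sink -> (i < 3)%nat -> 2 <= dist_to_side m n (sink i) d.
Proof.
  intros H Hi. specialize (H i Hi d). unfold blanks_toward in H.
  pose proof (filter_length_le (fun k => negb (is_sinkb sink (shift (sink i) d (Z.of_nat k))))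
    (seq 1 (Z.to_nat (dist_to_side m n (sink i) d)))) as Hle.
  rewrite length_seq in Hle. lia.
Qed.

Theorem mainTheorem13 (m n : Z) (sink : nat -> cell) :
  valid_board m n sink ->
  (has_perfect_layout m n sink <->
     cond1 m n sink /\
     ~ configA m n sink /\ ~ configB m n sink /\
     ~ configC m n sink /\ ~ configD m n sink /\
     cond3 m n sink).
Proof.
  intros HB. split.
  - intros [L HL].
    split; [eapply perfect_cond1; eauto|].
    split; [eapply perfect_not_configA; eauto|].
    split; [eapply perfect_not_configB; eauto|].
    split; [eapply perfect_not_configC; eauto|].
    split; [eapply perfect_not_configD; eauto|].
    eapply perfect_cond3; eauto.
  - intros (H1 & HA & HBc & HC & HD & H3). apply solvable_all; auto.
    intros; apply cond1_dist; auto.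
Qed.
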